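(* The pair of contravariant functors $\ast_{\mathcal G}$ (from graded bundles to graded polynomial algebra bundles, $F\mapsto F^{\ast}_{\mathcal G}$, $f\mapsto f^{\ast}_{\mathcal G}$) and $\star_{\mathcal G}$ (from graded polynomial algebra bundles to graded bundles, $\mathbf A\mapsto \mathbf A^{\star}_{\mathcal G}$, $\phi\mapsto\phi^{\star}_{\mathcal G}$) establishes a (contravariant) equivalence between the category $GB$ of graded bundles and the category $GPAB^\ast$ of graded polynomial algebra bundles with Zakrzewski morphisms.
   Context: Algebras are real, commutative, associative, with unit; algebra homomorphisms preserve units; $\mathbb N=\{0,1,2,\dots\}$. **Graded bundles.** Let $\mathcal G=(\mathbb R,\cdot)$ be the multiplicative monoid of reals. A graded bundle is a smooth manifold $F$ with a smooth action $h:\mathbb R\times F\to F$ of $\mathcal G$ ($h_t\circ h_s=h_{ts}$, $h_1=\mathrm{id}$). Its base is $M=h_0(F)$, its projection is $h_0:F\to M$. It is locally trivial with one typical fibre: there is $\mathbf d=(d_1,\dots,d_r)$, $d_i\in\mathbb N$, such that locally over $M$ it is isomorphic to $U\times\mathbb R^{\mathbf d}$, $\mathbb R^{\mathbf d}=\mathbb R^{d_1}\times\dots\times\mathbb R^{d_r}$, with $h_t(x,y_1,\dots,y_r)=(x,ty_1,\dots,t^ry_r)$. Morphisms in $GB$ are smooth maps intertwining the actions; such a map $f:F\to E$ covers a smooth map $\underline f$ of the bases. A function $f$ on $F$ is homogeneous of degree $i$ if $f\circ h_t=t^if$. **Algebras.** $\mathcal A(\mathbb R^{\mathbf d})=\mathbb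 R[y_i^a]$ ($1\le a\le d_i$) is the polynomial algebra graded by giving $y_i^a$ weight $i$. A graded polynomial algebra is a graded algebra isomorphic to some $\mathcal A(\mathbb R^{\mathbf d})$. Let $\mathbb A=\mathbb R[\varepsilon]$, graded by $\deg\varepsilon^i=i$, with the $\mathcal G$-action $h_t(\varepsilon^i)=t^i\varepsilon^i$. A map into $\mathbb A$ is smooth if its compositions with all projections $\mathbb A\to\mathbb A/\langle\varepsilon^{k+1}\rangle\simeq\mathbb R^{k+1}$ are smooth. **Bundles.** A locally finite-rank graded vector bundle over $M$ is $E=\bigoplus_{i\ge0}E^i$ with each $E^i\to M$ a finite-rank vector bundle. A graded polynomial algebra bundle is such a bundle $\mathbf A$ locally trivialized as $U\times A$, $A=\mathcal A(\mathbb R^{\mathbf d})$, with transition cocycles valued in graded algebra automorphisms of $A$ and smooth in each degree. A Zakrzewski morphism $\psi$ from $E\to M$ to $F\to N$ consists of a smooth map $\underline\psi:N\to M$ and, for each $x\in N$, degree-preserving linear maps $\psi_x:E_{\underline\psi(x)}\to F_x$, such that in each degree $i$ the dual maps form a smooth vector bundle morphism $(F^i)^\ast\to(E^i)^\ast$ over $\underline\psi$. Morphisms in $GPAB^\ast$ are Zakrzewski morphisms for which all $\psi_x$ are graded algebra homomorphisms. **Functors.** For a graded bundle $F\to M$, $F^{\ast}_{\mathcal G}\to M$ has fibres $(F^{\ast}_{\mathcal G})_x=\mathrm{Hom}_{\mathcal G}(F_x,\mathbb A)$, the algebra (pointwise operations) of smooth maps $F_x\to\mathbb A$ intertwining the actions;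 its degree-$i$ part consists of maps valued in $\mathbb R\varepsilon^i$ and its smooth sections correspond to smooth functions on $F$ homogeneous of degree $i$. For a morphism $f:F\to E$ over $\underline f:M\to N$, $f^{\ast}_{\mathcal G}$ is the Zakrzewski morphism from $E^{\ast}_{\mathcal G}$ to $F^{\ast}_{\mathcal G}$ over $\underline f$ given by $\alpha\mapsto\alpha\circ f_x$, where $f_x:F_x\to E_{\underline f(x)}$. For a graded polynomial algebra bundle $\mathbf A\to M$, $\mathbf A^{\star}_{\mathcal G}\to M$ has fibres $\mathrm{Hom}_{gr\text{-}alg}(\mathbf A_x,\mathbb A)$ (graded algebra homomorphisms) with action $(h_t\psi)(a)=h_t(\psi(a))$; its smooth structure is induced from local trivializations of $\mathbf A$ by identifying $\psi:\mathbb R[y^a_i]\to\mathbb A$, $\psi(y^a_i)=\lambda^a_i\varepsilon^i$, with $(\lambda^a_i)\in\mathbb R^{\mathbf d}$. For a morphism $\phi$ from $\mathbf B\to N$ to $\mathbf A\to M$ over $\underline\phi:M\to N$, $\phi^{\star}_{\mathcal G}:\mathbf A^{\star}_{\mathcal G}\to\mathbf B^{\star}_{\mathcal G}$ is $\zeta\mapsto\zeta\circ\phi_x$ over $\underline\phi$. *)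

(* Defs.v *)
From HB Require Import structures.
From mathcomp Require Import all_boot all_order all_algebra.
From mathcomp Require Import all_classical all_reals.
From mathcomp Require Import interval_inference topology normedtype landau derive.
From mathcomp Require Import -(notations) mpoly.

Set Implicit Arguments.
Unset Strict Implicit.
Unset Printing Implicit Defensive.

Import Order.TTheory GRing.Theory Num.Theory.
Import numFieldNormedType.Exports.
Local Open Scope classical_set_scope.
Local Open Scope ring_scope.

(* f is C^0 on O if it is continuous at the points of O, and C^(k+1) if it is
   differentiable there and all its directional derivatives are C^k on O. This
   is used for O open, V = R^m and W = R^n. *)
Fixpoint Ck (R : realType) (V W : normedModType R) (k : nat)
    (O : set V) (f : V -> W) : Prop :=
  match k with
  | 0 => forall x, O x -> {for x, continuous f}
  | k'.+1 => (forall x, O x -> differentiable f x) /\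
             forall v, Ck k' O (fun x => 'd f x v)
  end.

Definition Cinfty (R : realType) (V W : normedModType R)
    (O : set V) (f : V -> W) : Prop := forall k, Ck k O f.

Section Calculus.
Variable R : realType.
Implicit Types V W : normedModType R.

Lemma Ck_cont V W k (O : set V) (f : V -> W) :
  Ck k O f -> forall x, O x -> {for x, continuous f}.
Proof.
case: k => [|k] //= -[df _] x Ox.
exact/differentiable_continuous/df.
Qed.

Lemma CkS V W k (O : set V) (f : V -> W) : Ck k.+1 O f -> Ck k O f.
Proof.
elim: k f => [|k IH] f; first by move=> [df _] x Ox; exact/differentiable_continuous/df.
move=> [df Hd]; split => // v; exact/IH/Hd.
Qed.

Lemma Ck_sub V W k (O P : set V) (f : V -> W) : P `<=` O -> Ck k O f -> Ck k P f.
Proof.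
move=> PO; elim: k f => [|k IH] f; first by move=> H x /PO; exact: H.
move=> [df Hd]; split => [x /PO|v]; [exact: df|exact/IH/Hd].
Qed.

Lemma near_eq_o V W (f g : V -> W) (x : V) : (\near x, f x = g x) ->
  differentiable f x -> g \o shift x = cst (g x) + 'd f x +o_ 0 id.
Proof.
move=> fg /diff_locallyP[dc df].
have gx : g x = f x by rewrite (nbhs_singleton fg).
apply/eqaddoP => _/posnumP[e].
have /eqaddoP/(_ _ (gt0 e)) He := df.
have fg0 : \forall h \near (0 : V), f (h + x) = g (h + x).
  by move: fg; rewrite (near_shift 0) /= subr0.
apply: filterS2 fg0 He => h hfg.
by rewrite !fctE /= gx hfg.
Qed.

Lemma near_eq_diff V W (f g : V -> W) (x : V) : (\near x, f x = g x) ->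
  differentiable f x -> differentiable g x /\ 'd g x = 'd f x :> (V -> W).
Proof.
move=> fg df; have H := near_eq_o fg df.
have dgf : 'd g x = 'd f x :> (V -> W).
  by apply: diff_unique => //; exact: diff_continuous.
split => //; apply/diff_locallyP; rewrite dgf; split => //.
exact: diff_continuous.
Qed.

Lemma Ck_ext V W k (O : set V) (f g : V -> W) : open O ->
  (forall x, O x -> f x = g x) -> Ck k O f -> Ck k O g.
Proof.
move=> oO; elim: k f g => [|k IH] f g fg.
  move=> H x Ox; rewrite /prop_for /continuous_at -fg //.
  apply: cvg_trans (H x Ox); apply: near_eq_cvg.
  by near=> y; apply: fg; near: y; exact: open_nbhs_nbhs.
have nfg x : O x -> \near x, f x = g x.
  by move=> Ox; near=> y; apply: fg; near: y; exact: open_nbhs_nbhs.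
move=> [df Hd]; split => [x Ox|v].
  by have [] := near_eq_diff (nfg x Ox) (df x Ox).
apply: IH (Hd v) => x Ox.
by have [_ ->] := near_eq_diff (nfg x Ox) (df x Ox).
Unshelve. all: by end_near. Qed.

Lemma Ck_cst V W k (O : set V) (w : W) : Ck k O (fun=> w).
Proof.
elim: k w => [|k IH] w; first by move=> x _; exact: cvg_cst.
split => [x _|v]; first exact: differentiable_cst.
have -> : (fun x => 'd (fun=> w) x v) = (fun=> 0) :> (V -> W).
  by apply/funext => x; rewrite -/(cst w) diff_cst.
exact: IH.
Qed.

Lemma Ck_add V W k (O : set V) (f g : V -> W) : open O ->
  Ck k O f -> Ck k O g -> Ck k O (fun x => f x + g x).
Proof.
move=> oO; elim: k f g => [|k IH] f g.
  by move=> Hf Hg x Ox; apply: cvgD; [exact: Hf|exact: Hg].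
move=> [df Hf] [dg Hg]; split => [x Ox|v].
  exact: differentiableD (df x Ox) (dg x Ox).
apply: Ck_ext (IH _ _ (Hf v) (Hg v)) => // x Ox.
exact: (esym (congr1 (@^~ v) (diffD (df x Ox) (dg x Ox)))).
Qed.

Lemma Ck_sum V W k (O : set V) n (f : 'I_n -> V -> W) : open O ->
  (forall i, Ck k O (f i)) -> Ck k O (fun x => \sum_i f i x).
Proof.
move=> oO Hf; elim: n f Hf => [|n IH] f Hf.
  by apply: Ck_ext (Ck_cst k O (0 : W)) => // x _; rewrite big_ord0.
apply: (@Ck_ext _ _ _ _ (fun x => f ord0 x + \sum_i f (lift ord0 i) x)) => //.
  by move=> x _; rewrite big_ord_recl.
by apply: Ck_add => //; apply: IH.
Qed.

Lemma Ck_scalel V W k (O : set V) (f : V -> R) (w : W) : open O ->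
  Ck k O f -> Ck k O (fun x => f x *: w).
Proof.
move=> oO; elim: k f => [|k IH] f.
  move=> Hf x Ox; apply: cvgZr_tmp; exact: Hf.
move=> [df Hf]; split => [x Ox|v].
  exact/differentiableZl/df.
apply: Ck_ext (IH _ (Hf v)) => // x Ox.
by have -> := @diffZl _ _ _ f w x (df x Ox).
Qed.

Lemma Ck_mul V k (O : set V) (f g : V -> R) : open O ->
  Ck k O f -> Ck k O g -> Ck k O (fun x => f x * g x).
Proof.
move=> oO; elim: k f g => [|k IH] f g.
  by move=> Hf Hg x Ox; apply: cvgM; [exact: Hf|exact: Hg].
move=> Hf Hg; have [df Hdf] := Hf; have [dg Hdg] := Hg.
split => [x Ox|v].
  exact: differentiableM (df x Ox) (dg x Ox).
apply: (@Ck_ext _ _ _ _ (fun x => f x * 'd g x v + g x * 'd f x v)) => //.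
  move=> x Ox; exact: (esym (congr1 (@^~ v) (diffM (df x Ox) (dg x Ox)))).
apply: (Ck_add oO); apply: IH; [exact: (CkS Hf)|exact: (Hdg v)|exact: (CkS Hg)|].
exact: (Hdf v).
Qed.

Lemma Ck_coord V n k (O : set V) (f : V -> 'rV[R]_n) j : open O ->
  Ck k O f -> Ck k O (fun x => f x 0 j : R).
Proof.
move=> oO; elim: k f => [|k IH] f.
  move=> Hf x Ox.
  exact: (@continuous_comp _ _ _ f (fun N : 'rV[R]_n => N 0 j : R) x (Hf x Ox)
    (@coord_continuous R 1 n 0 j (f x))).
move=> [df Hf]; split => [x Ox|v].
  exact: (@differentiable_comp _ _ _ _ f (fun N : 'rV[R]_n => N 0 j : R) x
    (df x Ox) (differentiable_coord (f x) 0 j)).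
apply: Ck_ext (IH _ (Hf v)) => // x Ox.
pose c (N : 'rV[R]_n) : R := N 0 j.
have -> : (fun x0 => f x0 0 j : R) = c \o f by [].
rewrite (diff_comp (df x Ox) (differentiable_coord (f x) 0 j)).
have clin : linear c by move=> a u w; rewrite /c !mxE.
pose cM := GRing.isLinear.Build _ _ _ _ _ clin.
pose cL : {linear _ -> _} := HB.pack c cM.
suff -> : 'd c (f x) = cL :> (_ -> _) by [].
by rewrite -[c]/(cL : _ -> _) diff_lin //; exact: coord_continuous.
Qed.

Lemma Ck_coordP V n k (O : set V) (f : V -> 'rV[R]_n) : open O ->
  (forall j, Ck k O (fun x => f x 0 j : R)) -> Ck k O f.
Proof.
move=> oO H.
apply: (@Ck_ext _ _ _ _ (fun x => \sum_j f x 0 j *: delta_mx 0 j)) => //.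
  by move=> x _; rewrite -row_sum_delta.
by apply: Ck_sum => // j; exact: Ck_scalel.
Qed.

Lemma Ck_compR m n k (O : set 'rV[R]_m) (P : set 'rV[R]_n)
    (f : 'rV[R]_m -> 'rV[R]_n) (g : 'rV[R]_n -> R) : open O ->
  (forall x, O x -> P (f x)) -> Ck k O f -> Ck k P g -> Ck k O (g \o f).
Proof.
move=> oO OP; elim: k g => [|k IH] h.
  move=> Hf Hh x Ox; exact: (@continuous_comp _ _ _ f h x (Hf x Ox) (Hh _ (OP _ Ox))).
move=> Hf Hh; have [df Hdf] := Hf; have [dh Hdh] := Hh.
split => [x Ox|v].
  exact: (@differentiable_comp _ _ _ _ f h x (df x Ox) (dh _ (OP _ Ox))).
apply: (@Ck_ext _ _ _ _
    (fun x => \sum_j ('d f x v) 0 j * 'd h (f x) (delta_mx 0 j))) => //.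
  move=> x Ox; rewrite (diff_comp (df x Ox) (dh _ (OP _ Ox))) /=.
  rewrite [in RHS](row_sum_delta ('d f x v)) linear_sum.
  by apply: eq_bigr => j _; rewrite linearZ.
apply: (Ck_sum oO) => j; apply: (Ck_mul oO); first exact: (Ck_coord j oO (Hdf v)).
exact: (IH (fun y => 'd h y (delta_mx 0 j)) (CkS Hf) (Hdh _)).
Qed.

Lemma Ck_comp m n p k (O : set 'rV[R]_m) (P : set 'rV[R]_n)
    (f : 'rV[R]_m -> 'rV[R]_n) (g : 'rV[R]_n -> 'rV[R]_p) : open O -> open P ->
  (forall x, O x -> P (f x)) -> Ck k O f -> Ck k P g -> Ck k O (g \o f).
Proof.
move=> oO oP OP Hf Hg; apply: Ck_coordP => // j.
exact: (@Ck_compR _ _ _ _ P f (fun y => g y 0 j : R) oO OP Hf (Ck_coord j oP Hg)).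
Qed.

Lemma Ck_lin m n k (O : set 'rV[R]_m) (f : {linear 'rV[R]_m -> 'rV[R]_n}) :
  open O -> Ck k O f.
Proof.
move=> oO.
suff H : Ck k O (fun x => \sum_j (x 0 j : R) *: f (delta_mx 0 j)).
  apply: Ck_ext oO _ H => x _; rewrite [in RHS](row_sum_delta x) linear_sum.
  by apply: eq_bigr => j _; rewrite linearZ.
apply: (Ck_sum oO) => j; apply: (Ck_scalel _ oO).
pose c (N : 'rV[R]_m) : R := N 0 j.
have clin : linear c by move=> a u w; rewrite /c !mxE.
pose cM := GRing.isLinear.Build _ _ _ _ _ clin.
pose cL : {linear _ -> _} := HB.pack c cM.
have cc : continuous cL by exact: coord_continuous.
case: k => [|k]; first by move=> x _; exact: cc.
split => [x _|v]; first exact: (linear_differentiable _ cc).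
apply: Ck_ext oO _ (Ck_cst k O (cL v)) => x _.
exact: (esym (congr1 (@^~ v) (diff_lin (f := cL) x cc))).
Qed.
End Calculus.

(* Only the values of [cmap] on [cdom] matter. *)
Record chart (R : realType) (T : topologicalType) (n : nat) := Chart {
  cdom : set T;
  cmap :> T -> 'rV[R]_n }.

Definition is_chart (R : realType) (T : topologicalType) (n : nat)
    (c : chart R T n) : Prop :=
  [/\ open (cdom c),
      forall p, cdom c p -> {for p, continuous c},
      forall p q, cdom c p -> cdom c q -> c p = c q -> p = q
    & forall O, open O -> O `<=` cdom c -> open (c @` O)].

Record charted (R : realType) := Charted {
  csort :> topologicalType;
  cdim : nat;
  catlas : set (chart R csort cdim) }.
Arguments Charted {R}.
Arguments catlas {R} _ _.

Section Smooth.
Variable R : realType.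
Implicit Types X Y Z : charted R.

Definition smooth_at X Y (f : X -> Y) (p : X) : Prop :=
  {for p, continuous f} /\
  forall (c : chart R X (cdim X)) (e : chart R Y (cdim Y)),
    catlas X c -> catlas Y e -> cdom c p -> cdom e (f p) ->
    exists (O : set 'rV[R]_(cdim X)) (g : 'rV[R]_(cdim X) -> 'rV[R]_(cdim Y)),
      [/\ open O, O (c p), Cinfty O g & \forall q \near p, e (f q) = g (c q)].

Definition smooth_on X Y (U : set X) (f : X -> Y) : Prop :=
  forall p, U p -> smooth_at f p.

Definition smooth X Y (f : X -> Y) : Prop := smooth_on setT f.

(* Smoothness of the identity says that the transition maps are smooth. *)
Definition is_manifold X : Prop :=
  [/\ hausdorff_space X, @second_countable X,
      forall c, catlas X c -> is_chart c,
      forall p : X, exists2 c, catlas X c & cdom c p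
    & @smooth X X id].

Definition realC : charted R :=
  Charted (R : topologicalType) 1 [set Chart setT (fun x => const_mx x)].

Definition EucC (n : nat) : charted R :=
  Charted ('rV[R]_n : topologicalType) n [set Chart setT id].

Definition prod_chart X Y (c : chart R X (cdim X)) (e : chart R Y (cdim Y)) :
    chart R (X * Y)%type (cdim X + cdim Y) :=
  Chart (cdom c `*` cdom e) (fun p => row_mx (c p.1) (e p.2)).

Definition prodC X Y : charted R :=
  Charted (X * Y)%type (cdim X + cdim Y)
    [set ce | exists c e, [/\ catlas X c, catlas Y e & ce = prod_chart c e]].

Lemma near_all (T : topologicalType) (p : T) (P : T -> Prop) :
  (forall q, P q) -> \forall q \near p, P q.
Proof. by move=> H; apply: nearW. Qed.

Lemma Cinfty_comp m n p (O : set 'rV[R]_m) (P : set 'rV[R]_n)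
    (f : 'rV[R]_m -> 'rV[R]_n) (g : 'rV[R]_n -> 'rV[R]_p) : open O -> open P ->
  Cinfty O f -> Cinfty P g -> open (O `&` f @^-1` P) /\
  Cinfty (O `&` f @^-1` P) (g \o f).
Proof.
move=> oO oP Hf Hg.
have oOP : open (O `&` f @^-1` P).
  rewrite openE => x [Ox Px]; rewrite /interior.
  apply: filterI; first exact: open_nbhs_nbhs.
  apply: (Ck_cont (Hf 0) Ox); exact: open_nbhs_nbhs.
split => // k; apply: (@Ck_comp _ _ _ _ _ _ P) => //; first by move=> x [].
by apply: Ck_sub (Hf k) => x [].
Qed.

Lemma smooth_at_comp X Y Z (f : X -> Y) (g : Y -> Z) (p : X) :
  (exists2 e, catlas Y e & cdom e (f p)) ->
  smooth_at f p -> smooth_at g (f p) -> smooth_at (g \o f) p.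
Proof.
move=> [e Ye efp] [fc Hf] [gc Hg].
split; first exact: continuous_comp.
move=> c d Xc Zd cp dp.
have [ O [u [oO Op Hu fu]]] := Hf c e Xc Ye cp efp.
have [P [v [oP Pp Hv gv]]] := Hg e d Ye Zd efp dp.
have [oOP Huv] := Cinfty_comp oO oP Hu Hv.
exists (O `&` u @^-1` P), (v \o u); split => //.
  by split => //=; rewrite -(nbhs_singleton fu).
have gv' : \forall q \near p, d (g (f q)) = v (e (f q)) by exact: fc _ gv.
by apply: filterS2 fu gv' => q /= <-.
Qed.

Lemma smooth_at_ext X Y (f g : X -> Y) (p : X) :
  (\forall q \near p, f q = g q) -> smooth_at f p -> smooth_at g p.
Proof.
move=> fg [fc Hf]; have fgp := nbhs_singleton fg.
split.
  rewrite /prop_for /continuous_at -fgp.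
  by apply: cvg_trans fc; exact: near_eq_cvg.
move=> c e Xc Ye cp ep; rewrite -fgp in ep.
have [ O [u [oO Op Hu fu]]] := Hf c e Xc Ye cp ep.
exists O, u; split => //.
by apply: filterS2 fg fu => q ->.
Qed.

Lemma smooth_at_cst X Y (y : Y) (p : X) : smooth_at (fun=> y : Y) p.
Proof.
split; first exact: cvg_cst.
move=> c e _ _ _ _; exists setT, (fun=> e y); split; [exact: openT|by []| |].
- by move=> k; exact: Ck_cst.
- by apply: near_all => q /=; rewrite ?mxE.
Qed.

Lemma smooth_at_pair X Y Z (f : X -> Y) (g : X -> Z) (p : X) :
  smooth_at f p -> smooth_at g p ->
  @smooth_at X (prodC Y Z) (fun x => (f x, g x)) p.
Proof.
move=> [fc Hf] [gc Hg]; split; first exact: cvg_pair.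
move=> c _ Xc [e [d [Ye Zd ->]]] cp [/= ep dp].
have [ O [u [oO Op Hu fu]]] := Hf c e Xc Ye cp ep.
have [P [v [oP Pp Hv gv]]] := Hg c d Xc Zd cp dp.
exists (O `&` P), (fun x => row_mx (u x) (v x)); split => //.
- exact: openI.
- move=> k; apply: Ck_coordP; first exact: openI.
  move=> j; rewrite -(fintype.splitK j).
  case: (fintype.split j) => i /=.
    apply: (@Ck_ext _ _ _ _ _ (fun x => u x 0 i : R)); first exact: openI.
      by move=> x _; rewrite row_mxEl.
    by apply: Ck_coord; [exact: openI|apply: Ck_sub (Hu k) => x []].
  apply: (@Ck_ext _ _ _ _ _ (fun x => v x 0 i : R)); first exact: openI.
    by move=> x _; rewrite row_mxEr.
  by apply: Ck_coord; [exact: openI|apply: Ck_sub (Hv k) => x []].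
- by apply: filterS2 fu gv => q /= -> ->.
Qed.

Lemma Cinfty_lin m n (O : set 'rV[R]_m) (f : {linear 'rV[R]_m -> 'rV[R]_n}) :
  open O -> Cinfty O f.
Proof. by move=> oO k; exact: Ck_lin. Qed.

Lemma smooth_at_fst X Y (p : prodC X Y) :
  @smooth X X id -> @smooth_at (prodC X Y) X fst p.
Proof.
move=> H; split; first exact: cvg_fst.
move=> _ e [c [d [Xc Yd ->]]] Xe [/= cp dp] ep.
have [_ /(_ c e Xc Xe cp ep) [ O [u [oO Op Hu fu]]]] := H p.1 I.
have [oOP Huv] := @Cinfty_comp _ _ _ setT O
  (@lsubmx R 1 (cdim X) (cdim Y)) u openT oO (Cinfty_lin _ openT) Hu.
exists (setT `&` lsubmx @^-1` O), (u \o lsubmx); split => //=.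
  by split => //=; rewrite row_mxKl.
near=> q; rewrite row_mxKl.
by near: q; exact: (cvg_fst fu).
Unshelve. all: by end_near. Qed.

Lemma smooth_at_snd X Y (p : prodC X Y) :
  @smooth Y Y id -> @smooth_at (prodC X Y) Y snd p.
Proof.
move=> H; split; first exact: cvg_snd.
move=> _ e [c [d [Xc Yd ->]]] Xe [/= cp dp] ep.
have [_ /(_ d e Yd Xe dp ep) [ O [u [oO Op Hu fu]]]] := H p.2 I.
have [oOP Huv] := @Cinfty_comp _ _ _ setT O
  (@rsubmx R 1 (cdim X) (cdim Y)) u openT oO (Cinfty_lin _ openT) Hu.
exists (setT `&` rsubmx @^-1` O), (u \o rsubmx); split => //=.
  by split => //=; rewrite row_mxKr.
near=> q; rewrite row_mxKr.
by near: q; exact: (cvg_snd fu).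
Unshelve. all: by end_near. Qed.

Lemma smooth_EucC_id n : @smooth (EucC n) (EucC n) id.
Proof.
move=> p _; split; first exact: cvg_id.
move=> _ _ -> -> _ _; exists setT, id; split; [exact: openT|by []| |].
- exact: (@Cinfty_lin _ _ setT idfun openT).
- by apply: near_all => q /=; rewrite ?mxE.
Qed.

Lemma smooth_at_coord n j (p : EucC n) :
  @smooth_at (EucC n) realC (fun x : 'rV[R]_n => x 0 j) p.
Proof.
split; first exact: coord_continuous.
move=> _ _ -> -> _ _; exists setT, (fun u => const_mx (u 0 j)); split; [exact: openT|by []| |].
- move=> k; apply: Ck_coordP; first exact: openT.
  move=> i; apply: (@Ck_ext _ _ _ _ _ (fun x : 'rV[R]_n => x 0 j : R)).
  + exact: openT.
  + by move=> x _; rewrite mxE.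
  + apply: Ck_coord; first exact: openT.
    exact: (@Ck_lin _ _ _ _ setT idfun openT).
- by apply: near_all => q /=; rewrite ?mxE.
Qed.

Lemma smooth_at_row X n (f : X -> 'rV[R]_n) (p : X) :
  (forall j, @smooth_at X realC (fun x => f x 0 j) p) ->
  @smooth_at X (EucC n) f p.
Proof.
move=> H; split.
  apply/cvg_ballP => e e0.
  have : \forall q \near p, forall j, ball (f p 0 j) e (f q 0 j).
    apply: filter_forall => k; have [fc _] := H k.
    exact/fc/nbhsx_ballx.
  by apply: filterS => q Hq; split => // i j; rewrite (ord1 i).
move=> c _ Xc -> cp _ /=.
have /choice [Og HO] : forall j, exists Og : set 'rV[R]_(cdim X) * ('rV[R]_(cdim X) -> R),
    [/\ open Og.1, Og.1 (c p), forall k, Ck k Og.1 Og.2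
      & \forall q \near p, f q 0 j = Og.2 (c q)].
  move=> j; have [_ Hj] := H j.
  have [ O [g [oO Op Hg fg]]] := Hj c _ Xc (erefl _) cp I.
  exists (O, fun x => g x 0 0); split => //.
  - by move=> k; exact: Ck_coord.
  - by apply: filterS fg => q /= <-; rewrite mxE.
pose P := interior [set y | forall j, (Og j).1 y].
have PO j : P `<=` (Og j).1 by move=> y /interior_subset.
exists P, (fun y => \row_j (Og j).2 y); split.
- exact: open_interior.
- rewrite /P /interior /=.
  suff : \forall y \near (c p : 'rV[R]_(cdim X)), forall j, (Og j).1 y by [].
  apply: (filter_forall (F := nbhs (c p))) => j; have [oO Op _ _] := HO j.
  exact: open_nbhs_nbhs.
- move=> k; apply: Ck_coordP; first exact: open_interior.
  move=> j; apply: (@Ck_ext _ _ _ _ _ (Og j).2); first exact: open_interior.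
    by move=> x _; rewrite mxE.
  by apply: Ck_sub (PO j) _; have [] := HO j.
- have : \forall q \near p, forall j, f q 0 j = (Og j).2 (c q).
    by apply: filter_forall => j; have [] := HO j.
  by apply: filterS => q Hq; apply/rowP => j; rewrite mxE.
Unshelve. all: by end_near. Qed.

Lemma smooth_at_realC2 (op : R -> R -> R) (p : prodC realC realC) :
  (forall k, Ck k setT (fun u : 'rV[R]_(1 + 1) =>
     op (u 0 (lshift 1 0)) (u 0 (rshift 1 0)))) ->
  {for p, continuous (fun x : R * R => op x.1 x.2)} ->
  @smooth_at (prodC realC realC) realC (fun x => op x.1 x.2) p.
Proof.
move=> Hop opc; split => //.
move=> _ _ [_ [_ [-> -> ->]]] -> _ _.
exists setT, (fun u => const_mx (op (u 0 (lshift 1 0)) (u 0 (rshift 1 0)))).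
split; [exact: openT|by []| |].
- move=> k; apply: Ck_coordP; first exact: openT.
  move=> j; apply: Ck_ext (Hop k); first exact: openT.
  by move=> u _; rewrite mxE.
- by apply: near_all => q; rewrite row_mxEl row_mxEr !mxE.
Qed.

Lemma coverR (x : realC) : exists2 e, catlas realC e & cdom e x.
Proof. by eexists; [reflexivity|]. Qed.

Lemma coverE n (x : EucC n) : exists2 e, catlas (EucC n) e & cdom e x.
Proof. by eexists; [reflexivity|]. Qed.

Lemma coverP X Y (x : prodC X Y) :
  (exists2 e, catlas X e & cdom e x.1) -> (exists2 e, catlas Y e & cdom e x.2) ->
  exists2 e, catlas (prodC X Y) e & cdom e x.
Proof.
by move=> [c Xc cx] [e Ye ex]; exists (prod_chart c e) => //; exists c, e.
Qed.

Lemma Ck_coordT n k i : Ck k setT (fun u : 'rV[R]_n => u 0 i : R).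
Proof.
apply: Ck_coord; first exact: openT.
exact: (@Ck_lin _ _ _ _ setT idfun openT).
Qed.

Lemma smooth_at_addr X (f g : X -> R) (p : X) :
  @smooth_at X realC f p -> @smooth_at X realC g p ->
  @smooth_at X realC (fun x => f x + g x) p.
Proof.
move=> Hf Hg.
apply: (@smooth_at_comp _ _ _ _ (fun x : prodC realC realC => x.1 + x.2 : realC) p _
  (smooth_at_pair Hf Hg)); first exact: coverP (coverR _) (coverR _).
apply: smooth_at_realC2.
  by move=> k; apply: Ck_add; [exact: openT|exact: Ck_coordT|exact: Ck_coordT].
by apply: cvgD; [exact: cvg_fst|exact: cvg_snd].
Qed.

Lemma smooth_at_mulr X (f g : X -> R) (p : X) :
  @smooth_at X realC f p -> @smooth_at X realC g p ->
  @smooth_at X realC (fun x => f x * g x) p.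
Proof.
move=> Hf Hg.
apply: (@smooth_at_comp _ _ _ _ (fun x : prodC realC realC => x.1 * x.2 : realC) p _
  (smooth_at_pair Hf Hg)); first exact: coverP (coverR _) (coverR _).
apply: smooth_at_realC2.
  by move=> k; apply: Ck_mul; [exact: openT|exact: Ck_coordT|exact: Ck_coordT].
by apply: cvgM; [exact: cvg_fst|exact: cvg_snd].
Qed.

Lemma smooth_at_sumr X n (f : 'I_n -> X -> R) (p : X) :
  (forall i, @smooth_at X realC (f i) p) ->
  @smooth_at X realC (fun x => \sum_i f i x) p.
Proof.
elim: n f => [|n IH] f Hf.
  apply: (@smooth_at_ext _ realC (fun=> 0)); last exact: smooth_at_cst.
  by apply: near_all => x; rewrite big_ord0.
apply: (@smooth_at_ext _ realC (fun x => f ord0 x + \sum_i f (lift ord0 i) x)).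
  by apply: near_all => x; rewrite big_ord_recl.
by apply: smooth_at_addr => //; exact: IH.
Qed.

Lemma smooth_at_crd X n (f : X -> 'rV[R]_n) j (p : X) :
  @smooth_at X (EucC n) f p -> @smooth_at X realC (fun x => f x 0 j) p.
Proof.
move=> Hf; apply: (@smooth_at_comp X (EucC n) realC f (fun x : 'rV[R]_n => x 0 j : R)) => //.
  exact: coverE.
exact: smooth_at_coord.
Qed.

End Smooth.

Record category := Category {
  ob :> Type;
  hom : ob -> ob -> Type;
  idm : forall a, hom a a;
  cmp : forall a b c, hom b c -> hom a b -> hom a c;
  cmp1l : forall a b (f : hom a b), cmp (idm b) f = f;
  cmp1r : forall a b (f : hom a b), cmp f (idm a) = f;
  cmpA : forall a b c d (f : hom c d) (g : hom b c) (h : hom a b),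
    cmp f (cmp g h) = cmp (cmp f g) h }.
Arguments idm {C} a : rename.
Arguments cmp {C a b c} _ _ : rename.

Definition is_iso (C : category) (a b : C) (f : hom a b) : Prop :=
  exists g : hom b a, cmp g f = idm a /\ cmp f g = idm b.

Record cofunctor (C D : category) := Cofunctor {
  fob :> C -> D;
  fmor : forall a b : C, hom a b -> hom (fob b) (fob a);
  fmor1 : forall a : C, fmor (idm a) = idm (fob a);
  fmorM : forall (a b c : C) (f : hom b c) (g : hom a b),
    fmor (cmp f g) = cmp (fmor g) (fmor f) }.
Arguments fmor {C D} _ {a b} _.

Definition dual_equivalence (C D : category)
    (S : cofunctor C D) (T : cofunctor D C) : Prop :=
  (exists eta : forall a : C, hom a (T (S a)),
     (forall a, is_iso (eta a)) /\
     (forall (a b : C) (f : hom a b),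
        cmp (eta b) f = cmp (fmor T (fmor S f)) (eta a))) /\
  (exists eps : forall a : D, hom a (S (T a)),
     (forall a, is_iso (eps a)) /\
     (forall (a b : D) (f : hom a b),
        cmp (eps b) f = cmp (fmor S (fmor T f)) (eps a))).

Section GradedAlgebra.
Variable R : realType.

Record galg := Galg {
  gasort :> comAlgType R;
  gacomp : nat -> set gasort }.

Definition is_galg (A : galg) : Prop :=
  [/\ forall i (k : R) (a b : A),
        gacomp i a -> gacomp i b -> gacomp i (k *: a + b),
      gacomp 0 (1 : A),
      forall i j (a b : A), gacomp i a -> gacomp j b -> gacomp (i + j) (a * b),
      forall a : A, exists (n : nat) (u : nat -> A),
        (forall i, gacomp i (u i)) /\ a = \sum_(i < n) u i
    & forall (n : nat) (u : nat -> A), (forall i, gacomp i (u i)) ->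
        \sum_(i < n) u i = 0 -> forall i, (i < n)%N -> u i = 0].

Definition galg_hom (A B : galg) (f : A -> B) : Prop :=
  [/\ linear f, GRing.monoid_morphism f
    & forall i a, gacomp i a -> gacomp i (f a)].

Definition galg_iso (A B : galg) (f : A -> B) : Prop :=
  exists g : B -> A, [/\ cancel f g, cancel g f, galg_hom f & galg_hom g].

(* The algebra R[eps], with its action of the monoid (R, .). *)
Definition epsA : galg :=
  @Galg {poly R} (fun i => [set p | exists a : R, p = a *: 'X^i]).

Definition epsact (t : R) (p : epsA) : epsA := p \Po (t *: 'X).

(* For d = (d_1, ..., d_r), the coordinates y_i^a of R^d (1 <= i <= r,
   1 <= a <= d_i) are indexed by pairs (i, a), enumerated by 'I_(nvar d);
   [wt] gives y_i^a the weight i (indices of [d] start at 0). *)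
Definition widx (d : seq nat) : finType :=
  {i : 'I_(size d) & 'I_(nth 0%N d i)}.

Definition nvar (d : seq nat) : nat := #|widx d|.

Definition wt (d : seq nat) (k : 'I_(nvar d)) : nat :=
  (tag (enum_val k)).+1.

Definition mwt (d : seq nat) (m : multinom (nvar d)) : nat :=
  (\sum_k m k * wt k)%N.

Definition polyA (d : seq nat) : galg :=
  @Galg (mpoly (nvar d) R)
    (fun i => [set p | forall m, mcoeff m p != 0 -> mwt m = i]).

Definition polyX (d : seq nat) (k : 'I_(nvar d)) : polyA d :=
  mpolyX R (mX k).

(* The monomials of weight i; their total degree is at most i. *)
Definition wmon (d : seq nat) (i : nat) : finType :=
  {m : bmultinom (nvar d) i.+1 | mwt m == i}.

Definition wmonX (d : seq nat) (i : nat) (j : 'I_#|wmon d i|) : polyA d :=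
  mpolyX R (val (enum_val j)).

Lemma galg_hom_id (A : galg) : galg_hom (fun a : A => a).
Proof. by []. Qed.

Lemma galg_hom_comp (A B C : galg) (f : A -> B) (g : B -> C) :
  galg_hom f -> galg_hom g -> galg_hom (fun a => g (f a)).
Proof.
move=> [lf [f1 fM] fd] [lg [g1 gM] gd]; split.
- by move=> k a b; rewrite lf lg.
- by split; [rewrite f1 g1|move=> a b; rewrite fM gM].
- by move=> i a /fd /gd.
Qed.

Lemma epsact_hom t : galg_hom (@epsact t).
Proof.
split.
- by move=> k a b; rewrite /epsact linearP.
- by split => [|a b]; rewrite /epsact ?rmorph1 ?rmorphM.
- move=> i _ [a ->]; exists (a * t ^+ i).
  by rewrite /epsact linearZ /= comp_Xn_poly exprZn scalerA.
Qed.

Lemma epsactM t s p : epsact t (epsact s p) = epsact (t * s) p.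
Proof.
by rewrite /epsact -comp_polyA comp_polyZ comp_polyX scalerA mulrC.
Qed.

Lemma epsact1 p : epsact 1 p = p.
Proof. by rewrite /epsact scale1r comp_polyXr. Qed.

Lemma coef_epsact t (p : {poly R}) i : (epsact t p)`_i = t ^+ i * p`_i.
Proof.
rewrite /epsact; elim/poly_ind: p i => [|p c IH] i.
  by rewrite comp_poly0 !coef0 mulr0.
rewrite comp_poly_MXaddC coefD [in RHS]coefD -scalerAr coefZ !coefMX !coefC.
case: i => [|i] /=; first by rewrite mulr0 !add0r expr0 mul1r.
by rewrite !addr0 IH exprS mulrA.
Qed.

Lemma mwt_deg (d : seq nat) (m : multinom (nvar d)) : (mdeg m <= mwt m)%N.
Proof.
by rewrite mdegE /mwt; apply: leq_sum => k _; rewrite leq_pmulr.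
Qed.

Lemma wmon_sum (d : seq nat) i (p : polyA d) : gacomp i p ->
  p = \sum_j mcoeff (val (val (enum_val j : wmon d i))) p *: wmonX j.
Proof.
move=> Hp; apply/mpolyP => m.
rewrite linear_sum /=.
under eq_bigr do rewrite linearZ /= mcoeffX.
have [mi|mi] := eqVneq (mwt m) i; last first.
  rewrite big1 => [|j _].
    by apply/eqP; apply: contraNT mi => /Hp ->.
  have [E|] := eqVneq; last by rewrite mulr0.
  by move: mi; rewrite -E (eqP (valP (enum_val j))) eqxx.
have md : (mdeg m < i.+1)%N by rewrite ltnS -mi mwt_deg.
have bmw : mwt (BMultinom md) == i by rewrite /= mi.
pose w : wmon d i := exist _ (BMultinom md) bmw.
rewrite (bigD1 (enum_rank w)) //= big1 => [|j jw].
  by rewrite enum_rankK /= eqxx mulr1 addr0.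
have [E|] := eqVneq; last by rewrite mulr0.
case/eqP: jw; rewrite -[j]enum_valK; congr enum_rank.
by apply/val_inj/val_inj.
Qed.

Lemma wmonX_comp (d : seq nat) i (j : 'I_#|wmon d i|) : gacomp i (wmonX j).
Proof.
move=> m /=; rewrite /wmonX mcoeffX.
case: (eqVneq (val (val (enum_val j))) m) => [<- _|_].
  exact/eqP/(valP (enum_val j)).
by rewrite eqxx.
Qed.

End GradedAlgebra.
Arguments gacomp {R g} i _.
Arguments galg_hom {R A B} f.
Arguments galg_iso {R A B} f.
Arguments polyX {R d} k.
Arguments wmonX {R d i} j.

(* A graded bundle F with its base M, projection h_0 : F -> M, action
   h_t = gbact t, and d. The base h_0(F) is given as a manifold M together
   with a smooth embedding M -> F of which [gbproj] is a smooth retraction. *)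
Record pregb (R : realType) := PreGB {
  gbtot : charted R;
  gbbase : charted R;
  gbproj : gbtot -> gbbase;
  gbact : R -> gbtot -> gbtot;
  gbdim : seq nat }.

Section GradedBundle.
Variable R : realType.

Definition gb_base (F : pregb R) : Prop :=
  smooth (@gbproj R F) /\
  exists iota : gbbase F -> gbtot F,
    [/\ smooth iota, forall x, gbproj (iota x) = x
      & forall p, iota (gbproj p) = gbact 0 p].

Definition gb_locally_trivial (F : pregb R) : Prop :=
  forall x : gbbase F, exists (U : set (gbbase F))
    (y : gbtot F -> EucC R (nvar (gbdim F)))
    (s : prodC (gbbase F) (EucC R (nvar (gbdim F))) -> gbtot F),
    [/\ open U /\ U x,
        smooth_on (@gbproj R F @^-1` U) y /\ smooth_on [set z : prodC _ _ | U z.1] s,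
        forall p, U (gbproj p) -> s (gbproj p, y p) = p,
        forall z, U z.1 -> gbproj (s z) = z.1 /\ y (s z) = z.2
      & forall (t : R) p k, U (gbproj p) ->
          y (gbact t p) 0 k = t ^+ wt k * y p 0 k].

Definition is_gb (F : pregb R) : Prop :=
  [/\ is_manifold (gbtot F) /\ is_manifold (gbbase F),
      @smooth R (prodC (realC R) (gbtot F)) (gbtot F)
        (fun tp => gbact tp.1 tp.2),
      (forall (t s : R) (p : gbtot F), gbact t (gbact s p) = gbact (t * s) p) /\
      (forall p : gbtot F, gbact 1 p = p),
      gb_base F
    & gb_locally_trivial F].

Record gb := GB { gbpre :> pregb R; gbP : is_gb gbpre }.

Definition is_gbmor (F E : pregb R) (f : gbtot F -> gbtot E)
    (fb : gbbase F -> gbbase E) : Prop :=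
  [/\ smooth f,
      forall t p, f (gbact t p) = gbact t (f p)
    & forall p, gbproj (f p) = fb (gbproj p)].

(* The base map is determined by [gbmtot], and it is smooth. *)
Record gbmor (F E : pregb R) := GBMor {
  gbmtot : gbtot F -> gbtot E;
  gbmbase : gbbase F -> gbbase E;
  gbmP : is_gbmor gbmtot gbmbase }.

Lemma gbmor_eq (F E : pregb R) (f g : gbmor F E) :
  gbmtot f = gbmtot g -> gbmbase f = gbmbase g -> f = g.
Proof.
case: f g => [f fb fP] [g gb gP] /= fg fbgb; subst g gb.
by congr GBMor; exact: Prop_irrelevance.
Qed.

Lemma gbmor_id_subproof (F : gb) :
  is_gbmor (fun p : gbtot F => p) (fun x : gbbase F => x).
Proof. by split => //; have [[[]]] := gbP F. Qed.

Definition gbmor_id (F : gb) : gbmor F F := GBMor (gbmor_id_subproof F).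

Lemma gbmor_comp_subproof (F E D : gb) (f : gbmor E D) (g : gbmor F E) :
  is_gbmor (fun p => gbmtot f (gbmtot g p)) (fun x => gbmbase f (gbmbase g x)).
Proof.
have [sf hf pf] := gbmP f; have [sg hg pg] := gbmP g.
split => [p _|t p|p]; last by rewrite pf pg.
  apply: (@smooth_at_comp _ _ _ _ (gbmtot g) (gbmtot f)); last 2 first.
  - exact: sg.
  - exact: sf.
  by have [[[_ _ _ cov _] _] _ _ _ _] := gbP E.
by rewrite hg hf.
Qed.

Definition gbmor_comp (F E D : gb) (f : gbmor E D) (g : gbmor F E) : gbmor F D :=
  GBMor (gbmor_comp_subproof f g).

Definition GBcat : category.
Proof.
refine (@Category gb (fun F E => gbmor F E) gbmor_id gbmor_comp _ _ _).
- by move=> F E f; apply: gbmor_eq.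
- by move=> F E f; apply: gbmor_eq.
- by move=> F E D C f g h; apply: gbmor_eq.
Defined.

Lemma gbact_proj (F : gb) (t : R) (p : gbtot F) : gbproj (gbact t p) = gbproj p.
Proof.
have [_ _ [hM _] [_ [iota [_ pi ip]]] _] := gbP F.
by rewrite -[LHS]pi ip hM mul0r -ip pi.
Qed.

Definition fibre (F : pregb R) (x : gbbase F) : Type :=
  {p : gbtot F | gbproj p = x}.

Definition fibre_act (F : gb) (x : gbbase F) (t : R) (q : fibre x) : fibre x :=
  exist _ (gbact t (sval q)) (etrans (gbact_proj t (sval q)) (svalP q)).

(* Smoothness on the submanifold F_x of F: local smooth extensions. *)
Definition fibre_smooth (F : pregb R) (x : gbbase F) (n : nat)
    (a : fibre x -> 'rV[R]_n) : Prop :=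
  forall q : fibre x, exists g : gbtot F -> EucC R n,
    (\forall p \near sval q, smooth_at g p) /\
    (\forall p \near sval q, forall r : fibre x, sval r = p -> a r = g p).

(* The projection R[eps] -> R[eps]/<eps^(k+1)> = R^(k+1). *)
Definition trunc (k : nat) (p : {poly R}) : 'rV[R]_k.+1 := \row_j p`_j.

Record homG (F : gb) (x : gbbase F) := HomG {
  homfun :> fibre x -> epsA R;
  homsm : forall k, fibre_smooth (fun q => trunc k (homfun q));
  homeq : forall t q, homfun (fibre_act t q) = epsact t (homfun q) }.

HB.instance Definition _ (F : gb) (x : gbbase F) := gen_eqMixin (homG x).
HB.instance Definition _ (F : gb) (x : gbbase F) := gen_choiceMixin (homG x).

Section HomAlgebra.
Variables (F : gb) (x : gbbase F).
Implicit Types a b c : homG x.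

Lemma homG_eq a b : (forall q, a q = b q) -> a = b.
Proof.
case: a b => [a sa ea] [b sb eb] /= ab.
have E : a = b by exact/funext.
by subst b; congr HomG; exact: Prop_irrelevance.
Qed.

Lemma fibre_smooth_op n m (op : 'rV[R]_n -> 'rV[R]_n -> 'rV[R]_m)
    (u v : fibre x -> 'rV[R]_n) :
  (forall (f g : gbtot F -> 'rV[R]_n) p,
     @smooth_at R (gbtot F) (EucC R n) f p -> @smooth_at R (gbtot F) (EucC R n) g p ->
     @smooth_at R (gbtot F) (EucC R m) (fun z => op (f z) (g z)) p) ->
  fibre_smooth u -> fibre_smooth v ->
  fibre_smooth (fun q => op (u q) (v q)).
Proof.
move=> Hop Hu Hv q.
have [f [sf uf]] := Hu q; have [g [sg vg]] := Hv q.
exists (fun z => op (f z) (g z)); split.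
  by apply: filterS2 sf sg => p; exact: Hop.
by apply: filterS2 uf vg => p up vp r rp; rewrite (up r rp) (vp r rp).
Qed.

Lemma fibre_smooth_cst n (w : 'rV[R]_n) : fibre_smooth (fun _ : fibre x => w).
Proof.
move=> q; exists (fun=> w); split; apply: near_all => // p.
exact: smooth_at_cst.
Qed.

Lemma fibre_smooth_ext n (u v : fibre x -> 'rV[R]_n) : u =1 v ->
  fibre_smooth u -> fibre_smooth v.
Proof. by move=> /funext ->. Qed.

Lemma hom_lin_sm s a b k :
  fibre_smooth (fun q => trunc k (s *: a q + b q : {poly R})).
Proof.
apply: (@fibre_smooth_ext _ (fun q => s *: trunc k (a q) + trunc k (b q))).
  by move=> q; apply/rowP => j; rewrite !mxE coefD coefZ.
apply: (fibre_smooth_op (op := fun u v => s *: u + v)); [|exact: homsm|exact: homsm].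
move=> f g p sf sg; apply: smooth_at_row => j.
apply: (@smooth_at_ext _ _ (realC R) (fun z => s * f z 0 j + g z 0 j)).
  by apply: near_all => z; rewrite !mxE.
apply: smooth_at_addr; last exact: smooth_at_crd.
by apply: smooth_at_mulr; [exact: smooth_at_cst|exact: smooth_at_crd].
Qed.

Lemma hom_lin_eq s a b t (q : fibre x) :
  s *: a (fibre_act t q) + b (fibre_act t q) = epsact t (s *: a q + b q).
Proof. by rewrite !homeq /epsact linearP. Qed.

Definition hom_lin s a b : homG x := HomG (hom_lin_sm s a b) (hom_lin_eq s a b).

Lemma hom_cst_sm (s : R) k : fibre_smooth (fun _ : fibre x => trunc k (s%:P)).
Proof. exact: fibre_smooth_cst. Qed.

Lemma hom_cst_eq (s : R) t (q : fibre x) : s%:P = epsact t (s%:P : epsA R).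
Proof. by rewrite /epsact comp_polyC. Qed.

Definition hom_cst s : homG x := HomG (hom_cst_sm s) (hom_cst_eq s).

Lemma hom_mul_sm a b k : fibre_smooth (fun q => trunc k (a q * b q : {poly R})).
Proof.
pose op (u v : 'rV[R]_k.+1) : 'rV[R]_k.+1 :=
  \row_j \sum_(i < j.+1) u 0 (inord i) * v 0 (inord (j - i)).
apply: (@fibre_smooth_ext _ (fun q => op (trunc k (a q)) (trunc k (b q)))).
  move=> q; apply/rowP => j; rewrite !mxE coefM; apply: eq_bigr => i _.
  have ij : (i <= j)%N by rewrite -ltnS.
  have jk := ltn_ord j.
  by rewrite !mxE (inordK (leq_ltn_trans ij jk))
             (inordK (leq_ltn_trans (leq_subr i j) jk)).
apply: (fibre_smooth_op (op := op)); [|exact: homsm|exact: homsm].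
move=> f g p sf sg; apply: smooth_at_row => j.
apply: (@smooth_at_ext _ _ (realC R)
  (fun z => \sum_(i < j.+1) f z 0 (inord i) * g z 0 (inord (j - i)))).
  by apply: near_all => z; rewrite !mxE.
apply: smooth_at_sumr => i.
by apply: smooth_at_mulr; exact: smooth_at_crd.
Qed.

Lemma hom_mul_eq a b t (q : fibre x) :
  a (fibre_act t q) * b (fibre_act t q) = epsact t (a q * b q).
Proof. by rewrite !homeq /epsact rmorphM. Qed.

Definition hom_mul a b : homG x := HomG (hom_mul_sm a b) (hom_mul_eq a b).

Definition hom_zero := hom_cst 0.
Definition hom_add a b := hom_lin 1 a b.
Definition hom_opp a := hom_lin (-1) a hom_zero.
Definition hom_scale s a := hom_lin s a hom_zero.

Let homE := (scale1r, scaleN1r, addr0, add0r).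

Lemma hom_addA : associative hom_add.
Proof. by move=> a b c; apply: homG_eq => q /=; rewrite !homE addrA. Qed.
Lemma hom_addC : commutative hom_add.
Proof. by move=> a b; apply: homG_eq => q /=; rewrite !homE addrC. Qed.
Lemma hom_add0 : left_id hom_zero hom_add.
Proof. by move=> a; apply: homG_eq => q /=; rewrite !homE. Qed.
Lemma hom_addN : left_inverse hom_zero hom_opp hom_add.
Proof. by move=> a; apply: homG_eq => q /=; rewrite !homE addNr. Qed.

HB.instance Definition _ := GRing.isZmodule.Build (homG x)
  hom_addA hom_addC hom_add0 hom_addN.

Lemma hom_mulA : associative hom_mul.
Proof. by move=> a b c; apply: homG_eq => q /=; rewrite mulrA. Qed.
Lemma hom_mulC : commutative hom_mul.
Proof. by move=> a b; apply: homG_eq => q /=; rewrite mulrC. Qed.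
Lemma hom_mul1 : left_id (hom_cst 1) hom_mul.
Proof. by move=> a; apply: homG_eq => q /=; rewrite mul1r. Qed.
Lemma hom_mulDl : left_distributive hom_mul +%R.
Proof. by move=> a b c; apply: homG_eq => q /=; rewrite !homE mulrDl. Qed.
Lemma hom_1_neq0 : hom_cst 1 != 0 :> homG x.
Proof.
have [_ _ _ [_ [iota [_ pi _]]] _] := gbP F.
apply/eqP => /(congr1 (fun a : homG x => a (exist _ (iota x) (pi x)))) /=.
by move/eqP; rewrite oner_eq0.
Qed.

HB.instance Definition _ := GRing.Zmodule_isComNzRing.Build (homG x)
  hom_mulA hom_mulC hom_mul1 hom_mulDl hom_1_neq0.

Lemma hom_scaleA s t a : hom_scale s (hom_scale t a) = hom_scale (s * t) a.
Proof. by apply: homG_eq => q /=; rewrite !homE scalerA. Qed.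
Lemma hom_scale1 : left_id 1 hom_scale.
Proof. by move=> a; apply: homG_eq => q /=; rewrite !homE. Qed.
Lemma hom_scaleDr : right_distributive hom_scale +%R.
Proof. by move=> s a b; apply: homG_eq => q /=; rewrite !homE scalerDr. Qed.
Lemma hom_scaleDl a : {morph hom_scale^~ a : s t / s + t}.
Proof. by move=> s t; apply: homG_eq => q /=; rewrite !homE scalerDl. Qed.

HB.instance Definition _ := GRing.Zmodule_isLmodule.Build R (homG x)
  hom_scaleA hom_scale1 hom_scaleDr hom_scaleDl.

Lemma hom_scaleAl s a b : s *: (a * b) = (s *: a) * b.
Proof. by apply: homG_eq => q /=; rewrite !homE scalerAl. Qed.

HB.instance Definition _ := GRing.Lmodule_isLalgebra.Build R (homG x) hom_scaleAl.
HB.instance Definition _ := GRing.Lalgebra_isComAlgebra.Build R (homG x).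

Definition homG_galg : galg R :=
  @Galg R (homG x) (fun i => [set a | forall q, gacomp i (a q)]).

End HomAlgebra.
End GradedBundle.

(* A local trivialization x |-> tmap x : A(R^d) -> A_x over [tdom]. *)
Record triv (R : realType) (M : charted R) (A : M -> galg R) (d : seq nat) :=
  Triv {
    tdom : set M;
    tmap : forall x : M, polyA R d -> A x }.

(* A bundle of algebras is given by its fibres and an atlas of local
   trivializations. *)
Record pregpab (R : realType) := PreGPAB {
  pabase : charted R;
  pafib : pabase -> galg R;
  padim : seq nat;
  patriv : set (triv pafib padim) }.
Arguments patriv {R} p _.

Section AlgebraBundle.
Variable R : realType.

(* The components of the local section [s] over [O] are smooth in [T]. *)
Definition smooth_section (M : charted R) (A : M -> galg R) (d : seq nat)
    (T : triv A d) (O : set M) (s : forall x : M, A x) : Prop :=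
  exists c : M -> polyA R d,
    (forall m, @smooth_on R M (realC R) O (fun x => mcoeff m (c x))) /\
    (forall x, O x -> s x = tmap T x (c x)).

Definition is_gpab (A : pregpab R) : Prop :=
  [/\ is_manifold (pabase A),
      forall x : pabase A, is_galg (pafib x),
      forall T, patriv A T ->
        open (tdom T) /\ forall x, tdom T x -> galg_iso (tmap T x),
      forall x : pabase A, exists2 T, patriv A T & tdom T x
    & forall T T' i (p : polyA R (padim A)), patriv A T -> patriv A T' ->
        gacomp i p ->
        smooth_section T' (tdom T `&` tdom T') (fun x => tmap T x p)].

Record gpab := GPAB { gpabpre :> pregpab R; gpabP : is_gpab gpabpre }.

(* The functional eta on the degree i part of an algebra. *)
Definition dual_elt (A : galg R) (i : nat) (eta : A -> R) : Prop :=
  forall (k : R) (a b : A), gacomp i a -> gacomp i b ->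
    eta (k *: a + b) = k * eta a + eta b.

(* The coordinates of eta in (A^i_x)^* in the trivialization of the dual
   bundle (A^i)^* induced by T. *)
Definition dual_coord (M : charted R) (A : M -> galg R) (d : seq nat)
    (T : triv A d) (i : nat) (x : M) (eta : A x -> R) :
    EucC R #|wmon d i| :=
  \row_j eta (tmap T x (wmonX j)).

(* For a fibrewise linear f_x : A_(fb x) -> B_x (x in the base N of B), the map
   of total spaces (B^i)^* -> (A^i)^*, (x, eta) |-> (fb x, eta o f_x), over a
   smooth fb is smooth: this is read in local trivializations of the two dual
   bundles, where L is the second component of its local representative. *)
Definition dual_smooth (A B : pregpab R) (fb : pabase B -> pabase A)
    (f : forall x : pabase B, pafib (fb x) -> pafib x) (i : nat) : Prop :=
  forall (S : triv (@pafib R A) (padim A)) (T : triv (@pafib R B) (padim B))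
    (x0 : pabase B), patriv A S -> patriv B T -> tdom T x0 -> tdom S (fb x0) ->
  exists L : prodC (pabase B) (EucC R #|wmon (padim B) i|) ->
             EucC R #|wmon (padim A) i|,
    (forall v, smooth_at L (x0, v)) /\
    \forall x \near x0, forall eta : pafib x -> R, dual_elt i eta ->
      dual_coord S i (fun a => eta (f x a)) = L (x, dual_coord T i eta).

Definition is_zak (A B : pregpab R) (fb : pabase B -> pabase A)
    (f : forall x : pabase B, pafib (fb x) -> pafib x) : Prop :=
  [/\ smooth fb, forall x, galg_hom (f x) & forall i, dual_smooth f i].

Record zak (A B : pregpab R) := Zak {
  zbase : pabase B -> pabase A;
  zfib : forall x : pabase B, pafib (zbase x) -> pafib x;
  zakP : is_zak zfib }.
Arguments zfib {A B} z x _.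

Lemma zak_eq (A B : pregpab R) (fb : pabase B -> pabase A)
    (f g : forall x : pabase B, pafib (fb x) -> pafib x) (fP : is_zak f)
    (gP : is_zak g) : (forall x a, f x a = g x a) -> Zak fP = Zak gP.
Proof.
move=> fg; have E : f = g.
  by apply: functional_extensionality_dep => x; apply/funext => a.
by subst g; congr Zak; exact: Prop_irrelevance.
Qed.

Lemma manifold_id (M : charted R) : is_manifold M -> @smooth R M M id.
Proof. by case. Qed.

Lemma dual_elt_sum (A : galg R) i (eta : A -> R) n (k : 'I_n -> R)
    (a : 'I_n -> A) : dual_elt i eta ->
  (forall (s : R) (u v : A), gacomp i u -> gacomp i v -> gacomp i (s *: u + v)) ->
  gacomp i (0 : A) -> (forall j, gacomp i (a j)) ->
  eta (\sum_j k j *: a j) = \sum_j k j * eta (a j).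
Proof.
move=> Heta Hi H0 Ha.
have eta0 : eta 0 = 0.
  have := Heta 1 0 0 H0 H0.
  by rewrite scaler0 addr0 mul1r => /eqP; rewrite -subr_eq0 opprD addNKr oppr_eq0 => /eqP.
suff H : gacomp i (\sum_j k j *: a j) /\
    eta (\sum_j k j *: a j) = \sum_j k j * eta (a j) by case: H.
elim: n k a Ha => [|n IH] k a Ha; first by rewrite !big_ord0.
rewrite !big_ord_recl.
have [Hs Es] := IH (fun j => k (lift ord0 j)) (fun j => a (lift ord0 j)) (fun j => Ha _).
split; first exact: Hi.
by rewrite Heta // Es.
Qed.

Lemma linear_sum_galg (A B : galg R) (f : A -> B) n (k : 'I_n -> R)
    (a : 'I_n -> A) : linear f ->
  f (\sum_j k j *: a j) = \sum_j k j *: f (a j).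
Proof.
move=> lf; pose lfM := GRing.isLinear.Build _ _ _ _ _ lf.
pose lfL : {linear _ -> _} := HB.pack f lfM.
have -> : f = lfL by [].
by rewrite linear_sum; apply: eq_bigr => j _; rewrite linearZ.
Qed.

Lemma zak_id_subproof (A : gpab) :
  @is_zak A A (fun x => x) (fun x a => a).
Proof.
have [mfA gA tA covA trA] := gpabP A.
split; [exact: manifold_id|by move=> x; exact: galg_hom_id|].
move=> i S T x0 AS AT Tx0 Sx0.
have [oS isoS] := tA S AS; have [oT isoT] := tA T AT.
have /choice [c Hc] : forall j : 'I_#|wmon (padim A) i|,
    exists c : pabase A -> polyA R (padim A),
    (forall m, @smooth_on R _ (realC R) (tdom S `&` tdom T) (fun x => mcoeff m (c x))) /\
    (forall x, (tdom S `&` tdom T) x -> tmap S x (wmonX j) = tmap T x (c x)).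
  by move=> j; apply: (trA S T i) => //; exact: wmonX_comp.
pose Z := prodC (pabase A) (EucC R #|wmon (padim A) i|).
pose w (l : 'I_#|wmon (padim A) i|) : multinom _ := val (val (enum_val l)).
exists (fun z : Z => \row_j \sum_l mcoeff (w l) (c j z.1) *
  (z.2 : 'rV[R]__) 0 l); split.
  move=> v; apply: smooth_at_row => j.
  apply: (@smooth_at_ext _ _ (realC R) (fun z : Z => \sum_l
    mcoeff (w l) (c j z.1) * (z.2 : 'rV[R]__) 0 l)).
    by apply: near_all => z; rewrite mxE.
  apply: smooth_at_sumr => l; apply: smooth_at_mulr.
    apply: (@smooth_at_comp _ Z (pabase A) (realC R) fst
      (fun x => mcoeff (w l) (c j x))).
    - by case: mfA => _ _ _ cov _; exact: cov.
    - by apply: smooth_at_fst; exact: manifold_id.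
    - by have [sc _] := Hc j; apply: sc.
  apply: (@smooth_at_crd _ Z _ snd).
  by apply: smooth_at_snd; exact: smooth_EucC_id.
have nST : \forall x \near x0, tdom S x /\ tdom T x.
  by apply: filterI; apply: open_nbhs_nbhs.
apply: filterS nST => x [Sx Tx] eta Heta.
apply/rowP => j; rewrite !mxE.
have [_ Ec] := Hc j; rewrite Ec //.
have [gS [_ SK [_ _ hS] _]] := isoS x Sx.
have [gT [TK _ [lT _ hT] [_ _ hgT]]] := isoT x Tx.
have ci : gacomp i (c j x).
  rewrite -[c j x]TK -Ec //; apply: hgT; apply: hS; exact: wmonX_comp.
rewrite {1}(wmon_sum ci).
rewrite linear_sum_galg //.
have [Hlin _ _ _ _] := gA x.
rewrite (dual_elt_sum (i := i)) //.
- by apply: eq_bigr => l _; rewrite mxE.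
- exact: Hlin.
- have -> : (0 : pafib x) = -1 *: (tmap T x (c j x)) + tmap T x (c j x).
    by rewrite scaleN1r addNr.
  by apply: Hlin; exact: hT.
- by move=> l; apply: hT; exact: wmonX_comp.
Qed.

Definition zak_id (A : gpab) : zak A A := Zak (zak_id_subproof A).

Lemma zak_comp_subproof (A B C : gpab) (f : zak B C) (g : zak A B) :
  @is_zak A C (fun x => zbase g (zbase f x))
    (fun x a => zfib f x (zfib g (zbase f x) a)).
Proof.
have [sf hf df] := zakP f; have [sg hg dg] := zakP g.
have [mfB gB tB covB trB] := gpabP B.
have [mfC _ tC covC _] := gpabP C.
have sgf : smooth (fun x => zbase g (zbase f x)).
  move=> x _; apply: (@smooth_at_comp _ _ _ _ (zbase f) (zbase g)).
  - by case: mfB.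
  - exact: sf.
  - exact: sg.
split => //.
  by move=> x; apply: (galg_hom_comp (f := zfib g (zbase f x))).
move=> i S T x0 AS CT Tx0 Sx0.
have [V BV Vx0] := covB (zbase f x0).
have [L [sL EL]] := df i V T x0 BV CT Tx0 Vx0.
have [K [sK EK]] := dg i S V (zbase f x0) AS BV Vx0 Sx0.
exists (fun z => K (zbase f z.1, L z)); split.
  move=> v; apply: (@smooth_at_comp _ (prodC (pabase C) (EucC R #|wmon (padim C) i|))
    (prodC (pabase B) (EucC R #|wmon (padim B) i|)) _
    (fun z => (zbase f z.1, L z)) K).
  - apply: coverP; last exact: coverE.
    by case: mfB => _ _ _ cov _; exact: cov.
  - apply: smooth_at_pair; last exact: sL.
    apply: (@smooth_at_comp _ (prodC (pabase C) (EucC R #|wmon (padim C) i|))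
      (pabase C) (pabase B) fst (zbase f)); last exact: sf.
      by case: mfC => _ _ _ cov _; exact: cov.
    by apply: smooth_at_fst; exact: manifold_id.
  - exact: sK.
have [fc _] := sf x0 I.
have EK' := fc _ EK.
apply: filterS2 EL EK' => x ELx EKx eta Heta.
rewrite -ELx //= -EKx //.
move=> k a b ai bi; have [lf _ gf] := hf x.
by rewrite lf Heta //; exact: gf.
Qed.

Definition zak_comp (A B C : gpab) (f : zak B C) (g : zak A B) : zak A C :=
  Zak (zak_comp_subproof f g).

Definition GPABcat : category.
Proof.
refine (@Category gpab (fun A B => zak A B) zak_id zak_comp _ _ _).
- by move=> A B [fb f fP]; apply: zak_eq.
- by move=> A B [fb f fP]; apply: zak_eq.
- by move=> A B C D f g h; apply: zak_eq.
Defined.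

End AlgebraBundle.
Arguments zfib {R A B} z x _.

Section Functors.
Variable R : realType.

(* The function on F given by the i-th component of a section of F^*_G. *)
Definition sect_fun (F : gb R) (s : forall x : gbbase F, homG x) (i : nat)
    (p : gbtot F) : realC R :=
  (s (gbproj p) (exist _ p erefl))`_i.

(* F^*_G, with the smooth structure for which the smooth sections of degree i
   over O are the smooth functions on F over O homogeneous of degree i. *)
Definition star_triv (F : gb R) :
    set (triv (fun x : gbbase F => homG_galg x) (gbdim F)) :=
  [set T | [/\ open (tdom T),
      forall x, tdom T x -> galg_iso (tmap T x)
    & forall i (O : set (gbbase F)) (s : forall x : gbbase F, homG_galg x),
        open O -> O `<=` tdom T -> (forall x, O x -> gacomp i (s x)) ->
        (smooth_on (@gbproj R F @^-1` O) (sect_fun s i) <->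
         smooth_section T O s)]].

Definition star (F : gb R) : pregpab R :=
  PreGPAB (@star_triv F).

Definition fibre_map (F E : gb R) (f : gbmor F E) (x : gbbase F)
    (q : fibre x) : fibre (gbmbase f x) :=
  exist _ (gbmtot f (sval q))
    (etrans (let: And3 _ _ h := gbmP f in h (sval q))
            (congr1 (gbmbase f) (svalP q))).

Lemma fibre_eq (F : pregb R) (x : gbbase F) (q r : fibre x) :
  sval q = sval r -> q = r.
Proof.
case: q r => [q hq] [r hr] /= qr; subst r.
by congr exist; exact: Prop_irrelevance.
Qed.

Lemma star_mor_sm (F E : gb R) (f : gbmor F E) (x : gbbase F)
    (a : homG (gbmbase f x)) (k : nat) :
  fibre_smooth (fun q : fibre x => trunc k (a (fibre_map f q))).
Proof.
move=> q; have [g [sg ag]] := @homsm _ _ _ a k (fibre_map f q).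
have [sf _ pf] := gbmP f; have [fc _] := sf (sval q) I.
exists (fun p => g (gbmtot f p)); split.
  have fsg : \forall p \near sval q, smooth_at g (gbmtot f p) := fc _ sg.
  apply: filterS fsg => p sgp.
  have [[[_ _ _ cov _] _] _ _ _ _] := gbP E.
  exact: (@smooth_at_comp _ _ _ _ (gbmtot f) g p (cov _) (sf p I) sgp).
have fag : \forall p \near sval q, forall r : fibre (gbmbase f x),
  sval r = gbmtot f p -> trunc k (a r) = g (gbmtot f p) := fc _ ag.
by apply: filterS fag => p H r rp; apply: H; rewrite /= rp.
Qed.

Lemma star_mor_eq (F E : gb R) (f : gbmor F E) (x : gbbase F)
    (a : homG (gbmbase f x)) t (q : fibre x) :
  a (fibre_map f (fibre_act t q)) = epsact t (a (fibre_map f q)).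
Proof.
rewrite -homeq; congr (a _); apply: fibre_eq => /=.
by have [_ -> _] := gbmP f.
Qed.

Definition star_mor (F E : gb R) (f : gbmor F E) (x : gbbase F)
    (a : homG_galg (gbmbase f x)) : homG_galg x :=
  HomG (@star_mor_sm F E f x a) (@star_mor_eq F E f x a).

(* The total space of A^star_G, with fibres Hom_gr-alg(A_x, R[eps]). *)
Definition costar_tot (A : pregpab R) : Type :=
  {x : pabase A & {z : pafib x -> epsA R | galg_hom z}}.

Definition costar_proj (A : pregpab R) (z : costar_tot A) : pabase A := projT1 z.

(* The coordinates (lambda_i^a) of z, with z(y_i^a) = lambda_i^a eps^i. *)
Definition costar_coord (A : pregpab R) (T : triv (@pafib R A) (padim A))
    (z : costar_tot A) : EucC R (nvar (padim A)) :=
  \row_k (sval (projT2 z) (tmap T (projT1 z) (polyX k)))`_(wt k).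

HB.instance Definition _ (A : pregpab R) := gen_eqMixin (costar_tot A).
HB.instance Definition _ (A : pregpab R) := gen_choiceMixin (costar_tot A).

(* [O] is open if it is open in every local trivialization U x R^d. *)
Definition costar_open (A : pregpab R) (O : set (costar_tot A)) : Prop :=
  forall T z, patriv A T -> tdom T (costar_proj z) -> O z ->
    \forall w \near (costar_proj z, costar_coord T z),
      forall z', (costar_proj z', costar_coord T z') = w -> O z'.

Lemma costar_openT (A : pregpab R) : costar_open (@setT (costar_tot A)).
Proof. by move=> T z _ _ _; exact: near_all. Qed.

Lemma costar_openI (A : pregpab R) : setI_closed (@costar_open A).
Proof.
move=> O P oO oP T z AT Tz [Oz Pz].
by apply: filterS2 (oO T z AT Tz Oz) (oP T z AT Tz Pz) => w HO HP z' E;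
  split; [exact: HO|exact: HP].
Qed.

Lemma costar_open_bigU (A : pregpab R) (I : Type) (f : I -> set (costar_tot A)) :
  (forall i, costar_open (f i)) -> costar_open (\bigcup_i f i).
Proof.
move=> of_ T z AT Tz [i _ fz].
by apply: filterS (of_ i T z AT Tz fz) => w H z' /H; exists i.
Qed.

HB.instance Definition _ (A : pregpab R) :=
  isOpenTopological.Build (costar_tot A)
    (@costar_openT A) (@costar_openI A) (@costar_open_bigU A).

Definition costar_chart (A : pregpab R) (T : triv (@pafib R A) (padim A))
    (c : chart R (pabase A) (cdim (pabase A))) :
    chart R (costar_tot A) (cdim (pabase A) + nvar (padim A)) :=
  Chart [set z | tdom T (costar_proj z) /\ cdom c (costar_proj z)]
    (fun z => row_mx (c (costar_proj z)) (costar_coord T z)).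

Definition costar_charted (A : pregpab R) : charted R :=
  Charted (costar_tot A) (cdim (pabase A) + nvar (padim A))
    [set d | exists T c,
       [/\ patriv A T, catlas (pabase A) c & d = costar_chart T c]].

Definition costar_act (A : pregpab R) (t : R) (z : costar_charted A) :
    costar_charted A :=
  existT _ (projT1 z) (exist _ (fun a => epsact t (sval (projT2 z) a))
    (galg_hom_comp (svalP (projT2 z)) (epsact_hom t))).

Definition costar (A : pregpab R) : pregb R :=
  @PreGB R (costar_charted A) (pabase A) (@costar_proj A) (@costar_act A)
    (padim A).

Definition costar_mor (B A : pregpab R) (phi : zak B A)
    (z : gbtot (costar A)) : gbtot (costar B) :=
  existT _ (zbase phi (projT1 z))
    (exist _ (fun b => sval (projT2 z) (zfib phi (projT1 z) b))
      (galg_hom_comp (let: And3 _ h _ := zakP phi in h (projT1 z))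
                     (svalP (projT2 z)))).

Section StarFunctor.
Hypothesis HS : forall F : gb R, is_gpab (star F).
Hypothesis HSm : forall (F E : gb R) (f : gbmor F E),
  @is_zak R (star E) (star F) (gbmbase f) (@star_mor F E f).

Definition star_ob (F : GBcat R) : GPABcat R := GPAB (HS F).

Definition star_hom (F E : GBcat R) (f : hom F E) : hom (star_ob E) (star_ob F) :=
  Zak (HSm f).

Lemma star_hom1 (F : GBcat R) : star_hom (idm F) = idm (star_ob F).
Proof.
apply: zak_eq => x a; apply: homG_eq => q /=; congr (a _).
exact: fibre_eq.
Qed.

Lemma star_homM (F E D : GBcat R) (f : hom E D) (g : hom F E) :
  star_hom (cmp f g) = cmp (star_hom g) (star_hom f).
Proof.
apply: zak_eq => x a; apply: homG_eq => q /=; congr (a _).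
exact: fibre_eq.
Qed.

Definition star_functor : cofunctor (GBcat R) (GPABcat R) :=
  Cofunctor star_hom1 star_homM.

End StarFunctor.

Section CostarFunctor.
Hypothesis HT : forall A : gpab R, is_gb (costar A).
Hypothesis HTm : forall (B A : gpab R) (phi : zak B A),
  @is_gbmor R (costar A) (costar B) (@costar_mor B A phi) (zbase phi).

Definition costar_ob (A : GPABcat R) : GBcat R := GB (HT A).

Definition costar_hom (B A : GPABcat R) (phi : hom B A) :
    hom (costar_ob A) (costar_ob B) :=
  GBMor (HTm phi).

Lemma costar_tot_eq (A : pregpab R) x (u v : {z : pafib x -> epsA R | galg_hom z}) :
  (forall a, sval u a = sval v a) ->
  existT _ x u = existT _ x v :> costar_tot A.
Proof.
case: u v => [u hu] [v hv] /= uv; have {}uv : u = v by exact/funext.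
by subst v; congr existT; congr exist; exact: Prop_irrelevance.
Qed.

Lemma costar_hom1 (A : GPABcat R) : costar_hom (idm A) = idm (costar_ob A).
Proof.
apply: gbmor_eq => //; apply/funext => -[x z] /=.
exact: costar_tot_eq.
Qed.

Lemma costar_homM (A B C : GPABcat R) (f : hom B C) (g : hom A B) :
  costar_hom (cmp f g) = cmp (costar_hom g) (costar_hom f).
Proof.
apply: gbmor_eq => //; apply/funext => -[x z] /=.
exact: costar_tot_eq.
Qed.

Definition costar_functor : cofunctor (GPABcat R) (GBcat R) :=
  Cofunctor costar_hom1 costar_homM.

End CostarFunctor.
End Functors.
Arguments star {R} F.
Arguments star_mor {R F E} f x a.
Arguments costar {R} A.
Arguments costar_mor {R B A} phi z.

(* Main.v *)
From HB Require Import structures.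
From mathcomp Require Import all_boot all_order all_algebra.
From mathcomp Require Import all_classical all_reals.
From mathcomp Require Import interval_inference topology normedtype landau derive.
From mathcomp Require Import sequences realfun.
From mathcomp Require Import -(notations) mpoly.
Require Import Defs.

(* A smooth function g on R^d with g(h_t l) = t^i g(l) is a weighted-homogeneous
   polynomial: its partial derivatives are homogeneous of lower degree (or zero),
   hence polynomial by induction on i, and Euler's formula recovers g from them.
   So in a local trivialization an equivariant map F_x -> R[eps] is a sequence of
   polynomials of weights 0, 1, 2, ..., and by Baire's theorem only finitely many
   of them are nonzero, since each single value is a polynomial in eps. Therefore
   the fibres of F^*_G are the algebras A(R^d), and a trivialization of F induces
   one of F^*_G; the coefficients of a section depend smoothly on the base point
   because they are fixed linear combinations of values of the corresponding
   function at finitely many points.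
   Dually, a graded algebra homomorphism A(R^d) -> R[eps] is evaluation at
   (lambda_k eps^(wt k)), so A^star_G is locally U x R^d, and the transition maps
   are polynomial in lambda with smooth coefficients. In trivializations the unit
   p |-> (a |-> a(p)) and the counit a |-> (z |-> z(a)) are both the identity. *)

Set Implicit Arguments.
Unset Strict Implicit.
Unset Printing Implicit Defensive.

Import Order.TTheory GRing.Theory Num.Theory.
Import numFieldNormedType.Exports.
Local Open Scope classical_set_scope.
Local Open Scope ring_scope.

(** * Polynomial functions *)


(** The naturals below [size p] are distinct in a numeric domain, and a nonzero polynomial has fewer
    roots than its size. *)
Lemma poly_fun_eq0 (R : numDomainType) (p : {poly R}) :
  (forall t : R, p.[t] = 0) -> p = 0.
Proof.
move=> p0; apply/eqP/contraT => pn0.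
pose s := [seq i%:R : R | i <- iota 0 (size p)].
have us : uniq s by rewrite map_inj_uniq ?iota_uniq //; exact: mulrIn (oner_neq0 R).
have := max_poly_roots pn0 _ us.
rewrite size_map size_iota ltnn => -> //.
by apply/allP => t _; apply/rootP/p0.
Qed.

(** [muni] views p as a polynomial in the last variable over the polynomials in the others. No
    coefficient is lost, which allows induction on the number of variables. *)
Lemma mcoeff_muni n (R : comNzRingType) (p : mpoly n.+1 R) (m : multinom n.+1) :
  mcoeff (Multinom [tuple m (widen_ord (leqnSn n) i) | i < n]) (muni p)`_(m ord_max) = mcoeff m p.
Proof.
rewrite muniE coef_sum linear_sum [in RHS](mpolyE p) linear_sum /=.
apply: eq_bigr => m' _.
rewrite coefZ coefXn mulr_natr mcoeffMn !linearZ /= !mcoeffX.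
have [->|mm] := eqVneq m' m; first by rewrite !eqxx.
rewrite mulr0; have [E|] := eqVneq (m ord_max) _; last by rewrite mulr0n.
case: eqVneq => [E'|]; last by rewrite mulr0 mul0rn.
case/eqP: mm; apply/mnmP => i.
have [j ->|->] := unliftP ord_max i; last by rewrite E.
move/mnmP/(_ j): E'; rewrite !mnmE.
suff -> : widen_ord (leqnSn n) j = lift ord_max j by [].
by apply/val_inj; rewrite /= /bump leqNgt ltn_ord.
Qed.

Lemma horner_muni n (R : comNzRingType) (p : mpoly n.+1 R) (v : 'I_n.+1 -> R) :
  (map_poly (meval (fun i => v (widen_ord (leqnSn n) i))) (muni p)).[v ord_max]
  = meval v p.
Proof.
rewrite muniE rmorph_sum horner_sum mevalE; apply: eq_bigr => m _ /=.
rewrite map_polyZ /= map_polyXn hornerZ hornerXn mevalZ mevalX big_ord_recr mulrA.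
by under eq_bigr do rewrite mnmE.
Qed.

(** With the first n variables fixed, p is a univariate polynomial that vanishes everywhere, so its
    coefficients vanish at every choice of these variables and are zero by induction. *)
Lemma meval_eq0 n (R : numDomainType) (p : mpoly n R) :
  (forall v, meval v p = 0) -> p = 0.
Proof.
elim: n p => [|n IH] p p0.
  by move: (p0 (fun=> 0)); rewrite [p]nvar0_mpolyC mevalC => ->; rewrite mpolyC0.
have mu0 i : (muni p)`_i = 0.
  apply: IH => u; rewrite -coef_map /=.
  suff -> : map_poly (meval u) (muni p) = 0 by rewrite coef0.
  apply: poly_fun_eq0 => t.
  (* The point u extended by the value t of the last variable. *)
  pose v (i : 'I_n.+1) := if unlift ord_max i is Some j then u j else t.
  have vt : v ord_max = t by rewrite /v unlift_none.
  have vu j : v (widen_ord (leqnSn n) j) = u j.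
    have -> : widen_ord (leqnSn n) j = lift ord_max j.
      by apply/val_inj; rewrite /= /bump leqNgt ltn_ord.
    by rewrite /v liftK.
  by rewrite -(p0 v) -horner_muni vt (funext vu).
by apply/mpolyP => m; rewrite -mcoeff_muni mu0 !mcoeff0.
Qed.

(** * Weighted evaluation *)


Section WeightedEvaluation.
Variables (R : realType) (d : seq nat).
Implicit Types (p q : polyA R d) (l : 'rV[R]_(nvar d)) (m : multinom (nvar d)).

Definition peval p l : R := meval (fun k => l 0 k) p.

(** The homomorphism into R[eps] that corresponds to the point l of R^d. Its coefficient at eps^i is
    the value at l of the weight i part of p. *)
Definition pev l p : epsA R :=
  mmap (@polyC R) (fun k => l 0 k *: 'X^(wt k) : {poly R}) p.

Definition monev m l : R := \prod_k l 0 k ^+ m k.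

Lemma pevE l p : pev l p =
  \sum_(m <- msupp p) (mcoeff m p * monev m l) *: 'X^(mwt m).
Proof.
rewrite /pev /mmap; apply: eq_bigr => m _; rewrite mul_polyC -scalerA.
congr (_ *: _); rewrite /mmap1.
under eq_bigr do rewrite exprZn -exprM.
rewrite scaler_prod; congr (_ *: _).
rewrite -expr_sum /mwt; congr (_ ^+ _); apply: eq_bigr => k _; exact: mulnC.
Qed.

Lemma mXE n (k : 'I_n) : mX k = mnm1 k.
Proof. by apply/mnmP => j; rewrite mnm1E mnmE eq_sym. Qed.

Lemma pevX l k : pev l (polyX k) = l 0 k *: 'X^(wt k).
Proof. by rewrite /pev /polyX mXE mmapX mmap1U. Qed.

Lemma pev_is_galg_hom l : galg_hom (pev l).
Proof.
split.
- move=> a p q; rewrite /pev raddfD /= mmapZ; congr (_ + _).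
  exact: mul_polyC.
- by split; [exact: rmorph1|exact: rmorphM].
- move=> i p ip; exists (\sum_(m <- msupp p) mcoeff m p * monev m l).
  rewrite pevE scaler_suml !big_seq; apply: eq_bigr => m mp.
  by rewrite ip // -mcoeff_msupp.
Qed.

Lemma pev_homog i l p : gacomp i p -> pev l p = peval p l *: 'X^i.
Proof.
move=> ip; rewrite /peval mevalE pevE scaler_suml !big_seq.
by apply: eq_bigr => m mp; rewrite ip // -mcoeff_msupp.
Qed.

(** A graded z must send the generator y_k to a multiple of eps^(wt k), and z is determined by its
    values on generators. *)
Lemma galg_hom_pev (z : polyA R d -> epsA R) : galg_hom z ->
  forall p, z p = pev (\row_k (z (polyX k))`_(wt k)) p.
Proof.
move=> [lz [z1 zM] zd] p.
pose zl := GRing.isLinear.Build _ _ _ _ _ lz.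
pose zm := GRing.isMonoidMorphism.Build _ _ z (conj z1 zM).
pose zL : {lrmorphism _ -> _} := HB.pack z zl zm.
have zX k : z (polyX k) = (z (polyX k))`_(wt k) *: 'X^(wt k).
  have /zd[a ->] : gacomp (wt k) (polyX k : polyA R d).
    move=> m; rewrite mcoeffX; case: (eqVneq (mX k) m) => [<- _|]; last by rewrite eqxx.
    rewrite mXE /mwt (bigD1 k) //= mnm1E eqxx mul1n big1 ?addn0 // => j jk.
    by rewrite mnm1E eq_sym (negbTE jk).
  by rewrite coefZ coefXn eqxx mulr1.
rewrite -[z]/(zL : _ -> _) {1}[p]mpolyE linear_sum /pev /mmap.
apply: eq_bigr => m _; rewrite mul_polyC linearZ; congr (_ *: _).
rewrite [X in _ X = _]mpolyXE_id rmorph_prod /mmap1; apply: eq_bigr => k _.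
by rewrite rmorphXn mxE -zX /polyX mXE.
Qed.

(* The action h_t on R^d. *)
Definition dil (t : R) l : 'rV[R]_(nvar d) := \row_k (t ^+ wt k * l 0 k).

(** The left side is a graded homomorphism in p, hence itself an evaluation, and its point is found
    on the generators. *)
Lemma epsact_pev t l p : epsact t (pev l p) = pev (dil t l) p.
Proof.
rewrite (galg_hom_pev (galg_hom_comp (pev_is_galg_hom l) (epsact_hom t))).
congr pev; apply/rowP => k; rewrite !mxE pevX coef_epsact coefZ coefXn eqxx.
by rewrite mulr1.
Qed.

Definition pcomp i p : polyA R d :=
  \sum_(m <- msupp p | mwt m == i) mcoeff m p *: mpolyX R m.

Lemma mcoeff_pcomp i p m : mcoeff m (pcomp i p) = mcoeff m p *+ (mwt m == i).
Proof.
rewrite /pcomp linear_sum /= [in RHS](mpolyE p) linear_sum /= big_mkcond /= -sumrMnl.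
apply: eq_bigr => m' _; rewrite linearZ /= mcoeffX.
case: (eqVneq m' m) => [->|_]; first by case: ifP; rewrite ?mulr0n.
by rewrite mulr0 mul0rn if_same.
Qed.

Lemma pcomp_homog i p : gacomp i (pcomp i p).
Proof.
move=> m; rewrite mcoeff_pcomp; case: (eqVneq (mwt m) i) => // _.
by rewrite mulr0n eqxx.
Qed.

Lemma pcomp_sum p : exists n, p = \sum_(i < n) pcomp i p.
Proof.
(* One more than the largest weight that occurs in p, since the sum stops before n. *)
exists (\max_(m <- msupp p) mwt m).+1; apply/mpolyP => m; rewrite linear_sum /=.
under eq_bigr do rewrite mcoeff_pcomp.
have [mp|mp] := boolP (m \in msupp p); last first.
  move: mp; rewrite mcoeff_msupp negbK => /eqP ->.
    by rewrite big1 // => i _; rewrite mul0rn.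
have mb : (mwt m < (\max_(m <- msupp p) mwt m).+1)%N by rewrite ltnS leq_bigmax_seq.
rewrite (bigD1 (Ordinal mb)) //= eqxx mulr1n big1 ?addr0 // => i im.
by case: (eqVneq (mwt m) i) => // E; case/eqP: im; apply: val_inj.
Qed.

Lemma coef_pev i l p : (pev l p)`_i = peval (pcomp i p) l.
Proof.
rewrite pevE coef_sum /peval /pcomp linear_sum /= [RHS]big_mkcond /=.
apply: eq_bigr => m _; rewrite coefZ coefXn mulr_natr eq_sym.
by case: eqP; rewrite ?mulr0n // mevalZ mevalX.
Qed.

Lemma peval_eq0 p : (forall l, peval p l = 0) -> p = 0.
Proof.
move=> p0; apply: meval_eq0 => v; rewrite -(p0 (\row_k v k)).
by apply: meval_eq => k; rewrite mxE.
Qed.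

(** Homogeneity can be tested after evaluation: the coefficients of [pev l p] are the values of the
    weight components of p, and a component with only zero values is zero. *)
Lemma pev_homogP i p : (forall l j, j != i -> (pev l p)`_j = 0) -> gacomp i p.
Proof.
move=> H m mp; apply/eqP/contraT => mi.
have E : pcomp (mwt m) p = 0.
  by apply: peval_eq0 => l; rewrite -coef_pev H.
by move: mp; have := mcoeff_pcomp (mwt m) p m; rewrite E mcoeff0 eqxx mulr1n => <-; rewrite eqxx.
Qed.

Lemma pev_eq0 p : (forall l, pev l p = 0) -> p = 0.
Proof.
move=> H; have [n ->] := pcomp_sum p; rewrite big1 // => i _.
by apply: peval_eq0 => l; rewrite -coef_pev H coef0.
Qed.

Lemma pevB l p q : pev l (p - q) = pev l p - pev l q.
Proof. exact: raddfB. Qed.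

Lemma pev_eq p q : (forall l, pev l p = pev l q) -> p = q.
Proof.
by move=> H; apply/eqP; rewrite -subr_eq0; apply/eqP/pev_eq0 => l; rewrite pevB H subrr.
Qed.

Definition wmexp i (j : 'I_#|wmon d i|) : multinom (nvar d) := val (val (enum_val j)).

Lemma wmexpE i (j : 'I_#|wmon d i|) : wmonX j = mpolyX R (wmexp j) :> polyA R d.
Proof. by []. Qed.

Lemma mwt_wmexp i (j : 'I_#|wmon d i|) : mwt (wmexp j) = i.
Proof. exact/eqP/(valP (enum_val j)). Qed.

Lemma wmexp_inj i : injective (@wmexp i).
Proof. by move=> j k /val_inj/val_inj/enum_val_inj. Qed.

(** All weights are at least 1, so the total degree of m is at most i and m meets the degree bound
    built into [wmon]. *)
Lemma wmexp_surj i m : mwt m = i -> exists j : 'I_#|wmon d i|, wmexp j = m.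
Proof.
move=> mi; have md : (mdeg m < i.+1)%N by rewrite ltnS -mi mwt_deg.
have bmw : mwt (BMultinom md) == i by rewrite /= mi.
exists (enum_rank (exist _ (BMultinom md) bmw : wmon d i)).
by rewrite /wmexp enum_rankK.
Qed.

Lemma homog_wmexp i p : gacomp i p ->
  p = \sum_(j < #|wmon d i|) mcoeff (wmexp j) p *: wmonX j.
Proof. exact: wmon_sum. Qed.

Lemma peval_wmonX i (j : 'I_#|wmon d i|) l : peval (wmonX j) l = monev (wmexp j) l.
Proof. by rewrite /peval wmexpE mevalX. Qed.

Lemma peval_sum i (c : 'I_#|wmon d i| -> R) l :
  peval (\sum_j c j *: wmonX j) l = \sum_j c j * monev (wmexp j) l.
Proof.
by rewrite /peval linear_sum; apply: eq_bigr => j _ /=; rewrite mevalZ -peval_wmonX.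
Qed.

Lemma mcoeff_sum_wmonX i (c : 'I_#|wmon d i| -> R) k :
  mcoeff (wmexp k) (\sum_j c j *: wmonX j : polyA R d) = c k.
Proof.
rewrite linear_sum /= (bigD1 k) //= linearZ /= mcoeffX eqxx mulr1 big1 ?addr0 // => j jk.
by rewrite linearZ /= mcoeffX (inj_eq (@wmexp_inj i)) (negbTE jk) mulr0.
Qed.

Lemma sum_wmonX_homog i (c : 'I_#|wmon d i| -> R) :
  gacomp i (\sum_j c j *: wmonX j : polyA R d).
Proof.
move=> m; rewrite linear_sum /=; case: (eqVneq (mwt m) i) => // mi.
rewrite big1 ?eqxx // => j _; rewrite linearZ /= mcoeffX.
by case: eqVneq => [E|_]; [case/eqP: mi; rewrite -E mwt_wmexp|rewrite mulr0].
Qed.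

Lemma peval_homog i p l : gacomp i p ->
  peval p l = \sum_(j < #|wmon d i|) mcoeff (wmexp j) p * monev (wmexp j) l.
Proof. by move=> ip; rewrite {1}(homog_wmexp ip) peval_sum. Qed.

Lemma polyX_homog k : gacomp (wt k) (polyX k : polyA R d).
Proof. by apply: pev_homogP => l j jk; rewrite pevX coefZ coefXn (negbTE jk) mulr0. Qed.

Lemma polyA_is_galg : is_galg (polyA R d).
Proof.
split.
- move=> i a p q ip iq m; rewrite mcoeffD mcoeffZ => H; apply/eqP/contraT => mi.
  have p0 : mcoeff m p = 0 by apply/eqP; apply: contraNT mi => /ip ->.
  have q0 : mcoeff m q = 0 by apply/eqP; apply: contraNT mi => /iq ->.
  by move: H; rewrite p0 q0 mulr0 addr0 eqxx.
- apply: pev_homogP => l j j0; have [_ [-> _] _] := pev_is_galg_hom l.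
  by rewrite coef1 (negbTE j0).
- move=> i j p q ip iq; apply: pev_homogP => l k kij.
  have [_ [_ ->] _] := pev_is_galg_hom l; rewrite (pev_homog l ip) (pev_homog l iq).
  by rewrite -scalerAl -scalerAr scalerA -exprD coefZ coefXn (negbTE kij) mulr0.
- move=> p; have [n E] := pcomp_sum p.
  by exists n, (fun i => pcomp i p); split => // i; exact: pcomp_homog.
- move=> n u hu u0 i ni; apply/mpolyP => m.
  have [mi|mi] := eqVneq (mwt m) i; last first.
    by rewrite mcoeff0; apply/eqP; apply: contraNT mi => /hu ->.
  have := congr1 (mcoeff m) u0; rewrite linear_sum /= mcoeff0.
  rewrite (bigD1 (Ordinal ni)) //= big1 ?addr0 // => j ji.
  apply/eqP; apply: contraNT ji => /hu E; apply/eqP/val_inj; rewrite /= -E; exact: mi.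
Qed.

End WeightedEvaluation.


(** * Recovering coefficients from finitely many values *)

Lemma interpolation_points (F : fieldType) (V : Type) n (e : V -> 'rV[F]_n) :
  (forall c : 'cV_n, (forall v, e v *m c = 0) -> c = 0) ->
  exists v : 'I_n -> V, \matrix_i e (v i) \in unitmx.
Proof.
move=> He.
(* The points are chosen one at a time, keeping the rows independent. *)
suff H k : (k <= n)%N -> exists v : 'I_k -> V, row_free (\matrix_(i < k) e (v i)).
  by have [v vf] := H n (leqnn n); exists v; rewrite -row_free_unit.
elim: k => [|k IH] kn.
  have v0 : 'I_0 -> V by case.
  by exists v0; rewrite /row_free eqn_leq rank_leq_row.
have [v vf] := IH (ltnW kn); pose A := \matrix_(i < k) e (v i).
(* If every [e u] lay in the row space of A, each column of its cokernel would be annihilated by all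
   of them, hence zero by [He]; but the cokernel has rank n - k > 0. *)
have [w we] : exists w, ~~ (e w <= A)%MS.
  apply: contrapT => NH; have H u : (e u <= A)%MS.
    by apply/negPn/negP => eu; apply: NH; exists u.
  have /eqP := mxrank_coker A; rewrite (eqP vf).
  suff -> : cokermx A = 0 by rewrite mxrank0 eq_sym subn_eq0 leqNgt kn.
  apply/matrixP => i j; have := He (col j (cokermx A)) _.
  move=> /(_ _)/matrixP/(_ i 0); rewrite !mxE => -> // u.
  have := H u; rewrite submxE => /eqP E.
  by rewrite colE mulmxA E mul0mx.
exists (fun i : 'I_(1 + k) => if fintype.split i is inr j then v j else w).
have -> : \matrix_i e (if fintype.split i is inr j then v j else w) = col_mx (e w) A.
  apply/row_matrixP => i; rewrite rowK; case: fintype.splitP => j ij.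
    have -> : i = lshift k j by exact: val_inj.
    by rewrite rowKu; apply/rowP => b; rewrite !mxE (ord1 j).
  have -> : i = rshift 1 j by exact: val_inj.
  by rewrite rowKd rowK.
suff : (\rank A < \rank (col_mx (e w) A))%N.
  by rewrite (eqP vf) /row_free eqn_leq rank_leq_row.
rewrite -addsmxE; apply: rank_ltmx; rewrite /ltmx addsmxSr /=.
by apply: contra we => /(submx_trans (addsmxSl _ _)).
Qed.

Section Homogeneous.
Variables (R : realType) (d : seq nat).
Implicit Types (p q : polyA R d) (l : 'rV[R]_(nvar d)).

(** The points v and the weights b do not depend on p. Hence, when p varies with a parameter, its
    coefficients are as smooth as its values. *)
Lemma coef_interpolation i : exists (N : nat) (v : 'I_N -> 'rV[R]_(nvar d))
    (b : 'I_#|wmon d i| -> 'I_N -> R), forall p, gacomp i p ->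
  forall j, mcoeff (wmexp j) p = \sum_s b j s * peval p (v s).
Proof.
pose N := #|wmon d i|; exists N.
pose e l : 'rV[R]_N := \row_j monev (wmexp j) l.
have [v vu] : exists v : 'I_N -> _, \matrix_s e (v s) \in unitmx.
  (* A linear relation c that holds at all points is a polynomial without nonzero values, so its
     coefficients are zero. *)
  apply: interpolation_points => c Hc.
  have p0 : \sum_(j < N) c j 0 *: wmonX j = 0 :> polyA R d.
    apply: peval_eq0 => l; rewrite peval_sum; move/matrixP/(_ 0 0): (Hc l).
    by rewrite !mxE => E; rewrite -[RHS]E; apply: eq_bigr => j _; rewrite mxE mulrC.
  apply/colP => k; rewrite mxE.
  by rewrite -(mcoeff_sum_wmonX (fun j => c j 0) k) p0 mcoeff0.
exists v, (fun j s => invmx (\matrix_s e (v s)) j s) => p ip j.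
pose c : 'cV[R]_N := \col_j mcoeff (wmexp j) p.
have E : \matrix_s e (v s) *m c = \col_s peval p (v s).
  apply/colP => s; rewrite !mxE (peval_homog _ ip); apply: eq_bigr => k _.
  by rewrite !mxE mulrC.
have := mulKmx vu c; rewrite E => /colP/(_ j); rewrite !mxE => <-.
by apply: eq_bigr => s _; rewrite mxE.
Qed.

End Homogeneous.

(** * Smooth homogeneous functions *)


(** Extends to t = 0 the identities that are obtained by cancelling a power of t. *)
Lemma punctured_zero (R : realType) (h : R -> R) :
  {for 0, continuous h} -> (forall t, t != 0 -> h t = 0) -> h 0 = 0.
Proof.
move=> hc h0; have c1 : h t @[t --> 0^'] --> h 0 by apply/continuous_withinNx.
have c2 : h t @[t --> 0^'] --> (0 : R).
  apply: cvg_near_cst; have := @nbhs_dnbhs_neq R 0.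
  by apply: filterS => t /h0.
exact: (cvg_unique _ c1 c2).
Qed.

Lemma Ck_diff (R : realType) (V W : normedModType R) (f : V -> W) v :
  Cinfty setT f -> Cinfty setT (fun x => 'd f x v).
Proof. by move=> Hf k; have [_] := Hf k.+1; exact. Qed.

Section GradedAlgebraTheory.
Variables (R : realType) (A : galg R).
Hypothesis gA : is_galg A.

(** The decomposition of any element supplies some u in component i, and -u + u lies there too. *)
Lemma gacomp0 i : gacomp i (0 : A).
Proof.
have [lA _ _ dA _] := gA; have [n [u [hu _]]] := dA 0.
by have := lA i (-1) _ _ (hu i) (hu i); rewrite scaleN1r addNr.
Qed.

Lemma gacompD i (a b : A) : gacomp i a -> gacomp i b -> gacomp i (a + b).
Proof. by have [lA _ _ _ _] := gA => ia ib; have := lA i 1 _ _ ia ib; rewrite scale1r. Qed.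

Lemma gacompZ i k (a : A) : gacomp i a -> gacomp i (k *: a).
Proof.
by have [lA _ _ _ _] := gA => ia; have := lA i k _ _ ia (gacomp0 i); rewrite addr0.
Qed.

Lemma gacomp_sum i (I : Type) (r : seq I) (P : pred I) (a : I -> A) :
  (forall j, gacomp i (a j)) -> gacomp i (\sum_(j <- r | P j) a j).
Proof. by move=> Ha; elim/big_rec: _ => [|j x _]; [exact: gacomp0|exact: gacompD]. Qed.

End GradedAlgebraTheory.

Section Homogeneous.
Variables (R : realType) (d : seq nat).
Notation V := 'rV[R]_(nvar d).
Implicit Types (p q : polyA R d) (l : V).

Lemma dil_linear t : linear (@dil R d t).
Proof. by move=> a u v; apply/rowP => k; rewrite !mxE mulrDr mulrCA. Qed.

HB.instance Definition _ t := GRing.isLinear.Build R V V *:%R (@dil R d t) (dil_linear t).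

Lemma lin_row_continuous n m (f : {linear 'rV[R]_n -> 'rV[R]_m}) : continuous f.
Proof. by move=> x; exact: (Ck_lin 0 f openT). Qed.

Lemma dil_continuous t : continuous (@dil R d t).
Proof. exact: lin_row_continuous. Qed.

Lemma dil_delta t k : dil t (delta_mx 0 k) = t ^+ wt k *: delta_mx 0 k :> V.
Proof.
apply/rowP => j; rewrite !mxE eqxx /=.
by case: eqVneq => [->|_]; rewrite ?mulr0.
Qed.

Lemma dilE t l : dil t l = \sum_k t ^+ wt k *: (l 0 k *: delta_mx 0 k).
Proof.
by rewrite [in LHS](row_sum_delta l) linear_sum; apply: eq_bigr => k _;
  rewrite linearZ /= dil_delta scalerA mulrC -scalerA.
Qed.

Lemma dilV_continuous l : continuous (fun t : R => dil t l).
Proof.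
move=> t; rewrite (_ : (fun t => dil t l) =
    fun t => \sum_k t ^+ wt k *: (l 0 k *: delta_mx 0 k)); last first.
  by apply/funext => s; exact: dilE.
apply: (@Ck_sum R R V 0 setT _ _ openT) => // k s _; apply: cvgZr_tmp; exact: exprn_continuous.
Qed.

Lemma exp_derive1n n : 'D_(1 : R) (@GRing.exp R ^~ n) (1 : R) = n%:R.
Proof. by rewrite exp_derive expr1n /GRing.scale /= !mulr1. Qed.

(** The velocity at t = 1 is the weighted Euler vector field at l. *)
Lemma dilV_diff l : differentiable (fun t : R => dil t l : V) (1 : R) /\
  'd (fun t : R => dil t l : V) (1 : R) 1 = \sum_k (wt k)%:R *: (l 0 k *: delta_mx 0 k).
Proof.
have E : (fun t => dil t l) = \sum_k (fun t => t ^+ wt k *: (l 0 k *: delta_mx 0 k)).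
  by apply/funext => s; rewrite dilE fct_sumE.
have dk k : is_derive (1 : R) (1 : R) (fun t : R => t ^+ wt k *: (l 0 k *: delta_mx 0 k : V))
    ((wt k)%:R *: (l 0 k *: delta_mx 0 k)).
  have D : differentiable (@GRing.exp R ^~ (wt k)) (1 : R).
    by apply/derivable1_diffP; exact: exprn_derivable.
  have D' : differentiable (fun t : R => t ^+ wt k *: (l 0 k *: delta_mx 0 k : V)) (1 : R).
    exact: differentiableZl D.
  apply: DeriveDef; first exact/derivable1_diffP.
  by rewrite deriveE // (diffZl _ D) -(deriveE _ D) exp_derive1n.
have Ds := is_derive_sum dk.
have Dd : differentiable (\sum_k (fun t => t ^+ wt k *: (l 0 k *: delta_mx 0 k : V))) (1 : R).
  by apply/derivable1_diffP; exact: (@ex_derive _ _ _ _ _ _ _ Ds).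
have Ed : 'd (\sum_k (fun t => t ^+ wt k *: (l 0 k *: delta_mx 0 k : V))) (1 : R) 1 =
    \sum_k (wt k)%:R *: (l 0 k *: delta_mx 0 k).
  by rewrite -deriveE // derive_val.
by rewrite E.
Qed.

(** Differentiate g o dil_t = t^i g at l along the k-th basis vector, which dil_t multiplies by
    t^(wt k). *)
Lemma homog_diff i (g : V -> R) : (forall l, differentiable g l) ->
  (forall t l, g (dil t l) = t ^+ i * g l) ->
  forall t l k, t ^+ wt k * 'd g (dil t l) (delta_mx 0 k) =
                t ^+ i * 'd g l (delta_mx 0 k).
Proof.
move=> dg hg t l k.
have E : g \o dil t = t ^+ i \*: g by apply/funext => u /=; rewrite hg.
have ddil : differentiable (@dil R d t) l by apply: linear_differentiable; exact: dil_continuous.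
have E1 : 'd (g \o dil t) l (delta_mx 0 k) = 'd (t ^+ i \*: g) l (delta_mx 0 k) by rewrite E.
have E2 := congr1 (@^~ (delta_mx 0 k)) (diff_comp ddil (dg (dil t l))).
have E3 := congr1 (@^~ (delta_mx 0 k)) (@diffZ _ _ _ g (t ^+ i) l (dg l)).
have E4 := congr1 (@^~ (delta_mx 0 k)) (diff_lin l (@dil_continuous t)).
have E5 : 'd g (dil t l) (dil t (delta_mx 0 k)) = t ^+ i * 'd g l (delta_mx 0 k).
  exact: etrans (congr1 ('d g (dil t l)) (esym E4)) (etrans (esym E2) (etrans E1 E3)).
apply: etrans E5; apply: etrans (congr1 ('d g (dil t l)) (esym (dil_delta t k))).
exact: (esym (linearZ_LR ('d g (dil t l)) (t ^+ wt k) (delta_mx 0 k))).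
Qed.

(** Differentiate g(dil_t l) = t^i g(l) with respect to t at t = 1. *)
Lemma homog_euler i (g : V -> R) : (forall l, differentiable g l) ->
  (forall t l, g (dil t l) = t ^+ i * g l) ->
  forall l, i%:R * g l = \sum_k (wt k)%:R * (l 0 k * 'd g l (delta_mx 0 k)).
Proof.
move=> dg hg l; have [dd Ed] := dilV_diff l.
have dil1 : dil 1 l = l by apply/rowP => k; rewrite mxE expr1n mul1r.
have : 'd (g \o (fun t : R => dil t l : V)) (1 : R) 1 = i%:R * g l.
  rewrite (_ : g \o (fun t => dil t l) = fun t => t ^+ i *: (g l : R)); last first.
    by apply/funext => t /=; rewrite hg.
  have D : differentiable (@GRing.exp R ^~ i) (1 : R).
    by apply/derivable1_diffP; exact: exprn_derivable.
  by rewrite (diffZl _ D) -(deriveE _ D) exp_derive1n.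
rewrite (diff_comp dd (dg _)) /= Ed dil1 => <-; rewrite linear_sum.
by apply: eq_bigr => k _; rewrite !linearZ.
Qed.

Lemma homog_smooth_poly i (g : V -> R) : Cinfty setT g ->
  (forall t l, g (dil t l) = t ^+ i * g l) ->
  exists2 p : polyA R d, gacomp i p & forall l, g l = peval p l.
Proof.
elim/ltn_ind: i g => -[_|i IH] g sg hg.
  (* At t = 0 the dilation sends every l to 0 while t^0 = 1, so g is the constant g(0). *)
  exists (mpolyC (nvar d) (g 0)).
    apply: pev_homogP => l j j0; rewrite /pev mmapC coefC.
    by rewrite (negbTE j0).
  move=> l; rewrite /peval mevalC -[LHS]mul1r -(expr0 0) -hg; congr g.
  by apply/rowP => k; rewrite !mxE exprS !mul0r.
have dg l : differentiable g l by have [] := sg 1%N => + _; exact.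
(* The weight is recorded for [polyX k * q], so that directions of weight above i.+1, where q = 0,
   involve no negative degree. *)
have /choice[q Hq] : forall k, exists q : polyA R d, gacomp i.+1 (polyX k * q) /\
    forall l, 'd g l (delta_mx 0 k) = peval q l.
  move=> k; have sgk := Ck_diff (delta_mx 0 k) sg.
  have gkc l : {for 0, continuous (fun t => 'd g (dil t l) (delta_mx 0 k))}.
    exact: (@continuous_comp _ _ _ (fun t : R => dil t l) (fun u => 'd g u (delta_mx 0 k)) 0
      (@dilV_continuous l 0) (sgk 0%N _ I)).
  have H := homog_diff dg hg.
  have [ki|ki] := leqP (wt k) i.+1.
    (* Weights are positive, so this degree is smaller. Cancelling t^(wt k) gives the homogeneity
       for t nonzero, and continuity gives it at t = 0. *)
    have [||q qi qE] := IH (i.+1 - wt k)%N _ _ sgk.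
    - by rewrite ltn_subrL.
    - move=> t l; apply/eqP; rewrite -subr_eq0; apply/eqP; move: t.
      pose h t := 'd g (dil t l) (delta_mx 0 k) -
        t ^+ (i.+1 - wt k) * 'd g l (delta_mx 0 k) : R.
      have hn0 t : t != 0 -> h t = 0.
        move=> t0; apply: (mulfI (expf_neq0 (wt k) t0)); rewrite mulr0 mulrBr H.
        by rewrite mulrA -exprD subnKC // subrr.
      have h0 : h 0 = 0.
        apply: punctured_zero hn0; apply: cvgB; first exact: gkc.
        by apply: cvgMr_tmp; exact: exprn_continuous.
      by move=> t; have [->|/hn0] := eqVneq t 0.
    exists q; split => //; rewrite -(subnKC ki).
    have [_ _ M _ _] := polyA_is_galg R d.
    exact: (M _ _ _ _ (@polyX_homog R d k) qi).
  (* Here wt k exceeds i.+1. Cancelling t^(i+1) writes the derivative at l as a positive power of t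
     times the derivative at [dil t l]; letting t tend to 0 shows that it is zero. *)
  exists 0; split; first by move=> m; rewrite mulr0 mcoeff0 eqxx.
  move=> l; rewrite /peval meval0.
  pose h t := 'd g l (delta_mx 0 k) - t ^+ (wt k - i.+1) * 'd g (dil t l) (delta_mx 0 k) : R.
  have hn0 t : t != 0 -> h t = 0.
    move=> t0; apply: (mulfI (expf_neq0 i.+1 t0)); rewrite mulr0 mulrBr mulrA.
    by rewrite -exprD subnKC ?(ltnW ki) // H subrr.
  have h0 : h 0 = 0.
    apply: punctured_zero hn0; apply: cvgB; first exact: cvg_cst.
    by apply: cvgM; [exact: exprn_continuous|exact: gkc].
  by move: h0; rewrite /h expr0n subn_eq0 leqNgt ki mul0r subr0.
(* Euler's formula divided by the degree. *)
exists (i.+1%:R^-1 *: \sum_k (wt k)%:R *: (polyX k * q k)).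
  have gP := polyA_is_galg R d; apply: (gacompZ gP); apply: (gacomp_sum gP) => k.
  by apply: (gacompZ gP); have [] := Hq k.
move=> l; rewrite /peval mevalZ linear_sum /=.
apply: (mulfI (_ : i.+1%:R != 0)); first by rewrite pnatr_eq0.
rewrite mulVKf ?pnatr_eq0 // homog_euler //; apply: eq_bigr => k _.
have [_ ->] := Hq k; rewrite mevalZ mevalM; congr (_ * (_ * _)).
by rewrite /polyX mXE mevalXU.
Qed.

End Homogeneous.


(** * Smooth dependence of evaluations, and finiteness by Baire's theorem *)

Lemma poly_itv_eq0 (R : realFieldType) (q : {poly R}) (e : R) : 0 < e ->
  (forall t, 0 < t < e -> q.[t] = 0) -> q = 0.
Proof.
move=> e0 q0; apply/eqP/contraT => qn0.
(* Denominators start at 2, so that all these points lie strictly between 0 and e. *)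
pose s := [seq e / (i.+2)%:R | i <- iota 0 (size q)].
have us : uniq s.
  rewrite map_inj_uniq ?iota_uniq // => i j /(mulfI (lt0r_neq0 e0))/invr_inj/eqP.
  by rewrite eqr_nat => /eqP[].
have := max_poly_roots qn0 _ us; rewrite size_map size_iota ltnn => -> //.
apply/allP => _ /mapP[i _ ->]; apply/rootP/q0; rewrite divr_gt0 ?ltr0n //=.
by rewrite ltr_pdivrMr ?ltr0n // ltr_pMr // ltr1n.
Qed.

(** Baire's theorem is applied to R^d below and asks for a complete normed space. *)
HB.instance Definition _ (R : realType) n := Complete.on 'rV[R]_n.

Section SmoothEvaluation.
Variables (R : realType) (d : seq nat).
Implicit Types (p q : polyA R d) (l : 'rV[R]_(nvar d)) (X : charted R).

Lemma smooth_at_sum_seq X (I : Type) (r : seq I) (f : I -> X -> R) (x : X) :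
  (forall i, @smooth_at R X (realC R) (f i) x) ->
  @smooth_at R X (realC R) (fun x => \sum_(i <- r) f i x) x.
Proof.
move=> Hf; elim: r => [|i r IH].
  apply: (@smooth_at_ext _ _ (realC R) (fun=> 0)); last exact: smooth_at_cst.
  by apply: near_all => y; rewrite big_nil.
apply: (@smooth_at_ext _ _ (realC R) (fun y => f i y + \sum_(i <- r) f i y)).
  by apply: near_all => y; rewrite big_cons.
exact: smooth_at_addr.
Qed.

Lemma smooth_at_prod_seq X (I : Type) (r : seq I) (f : I -> X -> R) (x : X) :
  (forall i, @smooth_at R X (realC R) (f i) x) ->
  @smooth_at R X (realC R) (fun x => \prod_(i <- r) f i x) x.
Proof.
move=> Hf; elim: r => [|i r IH].
  apply: (@smooth_at_ext _ _ (realC R) (fun=> 1)); last exact: smooth_at_cst.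
  by apply: near_all => y; rewrite big_nil.
apply: (@smooth_at_ext _ _ (realC R) (fun y => f i y * \prod_(i <- r) f i y)).
  by apply: near_all => y; rewrite big_cons.
exact: smooth_at_mulr.
Qed.

Lemma smooth_at_exp X n (f : X -> R) (x : X) :
  @smooth_at R X (realC R) f x -> @smooth_at R X (realC R) (fun x => f x ^+ n) x.
Proof.
move=> Hf; apply: (@smooth_at_ext _ _ (realC R) (fun x => \prod_(i <- iota 0 n) f x)).
  by apply: near_all => y; rewrite big_const_seq count_predT size_iota iter_mulr_1.
exact: smooth_at_prod_seq.
Qed.

Lemma smooth_at_monev X m (f : X -> 'rV[R]_(nvar d)) (x : X) :
  @smooth_at R X (EucC R (nvar d)) f x ->
  @smooth_at R X (realC R) (fun x => monev m (f x)) x.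
Proof.
move=> Hf; apply: smooth_at_prod_seq => k; apply: smooth_at_exp.
exact: smooth_at_crd.
Qed.

Lemma smooth_at_peval X p (f : X -> 'rV[R]_(nvar d)) (x : X) :
  @smooth_at R X (EucC R (nvar d)) f x ->
  @smooth_at R X (realC R) (fun x => peval p (f x)) x.
Proof.
move=> Hf; apply: smooth_at_sum_seq => m; apply: smooth_at_mulr.
  exact: smooth_at_cst.
exact: smooth_at_monev.
Qed.

Lemma peval_continuous p : continuous (peval p).
Proof.
by move=> l; have [] := smooth_at_peval p (smooth_EucC_id (R := R) (n := nvar d) (p := l) I).
Qed.

Lemma peval_line p l u : exists q : {poly R}, forall t, q.[t] = peval p (l + t *: u).
Proof.
exists (mmap (@polyC R) (fun k => (l 0 k)%:P + u 0 k *: 'X : {poly R}) p) => t.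
rewrite /mmap horner_sum /peval mevalE; apply: eq_bigr => m _.
rewrite hornerM hornerC /mmap1 horner_prod; congr (_ * _); apply: eq_bigr => k _.
by rewrite horner_exp hornerD hornerC hornerZ hornerX !mxE mulrC.
Qed.

(** Join a point l0 of the open set to a point l1 with p(l1) nonzero. If p vanished on the open set,
    its restriction to this line would vanish for small t > 0, hence identically, also at t = 1. *)
Lemma peval_dense p : p != 0 -> dense [set l | peval p l != 0].
Proof.
move=> pn0 O [l0 Ol0] oO.
have [l1 pl1] : exists l1, peval p l1 != 0.
  apply: contrapT => H; case/eqP: pn0; apply: peval_eq0 => l.
  by apply/eqP/negPn/negP => pl; apply: H; exists l.
have [q Eq] := peval_line p l0 (l1 - l0).
have cl : {for (0 : R), continuous (fun t : R => l0 + t *: (l1 - l0))}.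
  by apply: cvgD; [exact: cvg_cst|apply: cvgZr_tmp; exact: cvg_id].
have : \forall t \near (0 : R), O (l0 + t *: (l1 - l0)).
  by apply: cl; rewrite scale0r addr0; exact: open_nbhs_nbhs.
case/nbhs_ballP => e /= e0 He.
apply: contrapT => NH; have q0 : q = 0.
  apply: (poly_itv_eq0 e0) => t /andP[t0 te]; rewrite Eq; apply/eqP/negPn/negP => pt.
  apply: NH; exists (l0 + t *: (l1 - l0)); split => //; apply: He.
  by rewrite /ball /= sub0r normrN gtr0_norm.
by move: pl1; have := Eq 1; rewrite q0 horner0 scale1r addrC subrK => <-; rewrite eqxx.
Qed.

(** Otherwise each set [F n] of points where some P_i with i >= n is nonzero is open and dense. A
    point common to all of them, which Baire's theorem supplies, contradicts the pointwise bound. *)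
Lemma peval_eventually0 (P : nat -> polyA R d) :
  (forall l, exists n, forall i, (n <= i)%N -> peval (P i) l = 0) ->
  exists n, forall i, (n <= i)%N -> P i = 0.
Proof.
move=> HP; apply: contrapT => NH.
have H n : exists i, (n <= i)%N /\ P i != 0.
  apply: contrapT => Hn; apply: NH; exists n => i ni.
  by apply/eqP/negPn/negP => Pi; apply: Hn; exists i.
pose F n := [set l | exists i, (n <= i)%N /\ peval (P i) l != 0].
have oF n : open (F n).
  rewrite (_ : F n = \bigcup_(i in [set i | (n <= i)%N]) (peval (P i) @^-1` [set~ 0])).
    apply: bigcup_open => i _; apply: open_comp => [l _|]; first exact: peval_continuous.
    by rewrite openC; exact: closed_eq.
  apply/seteqP; split => [l [i [ni Pi]]|l [i ni /= /eqP Pi]]; first by exists i => //; apply/eqP.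
  by exists i.
have dF n : dense (F n).
  have [i [ni Pi]] := H n => O O0 oO; have [l [Ol Pl]] := peval_dense Pi O0 oO.
  by exists l; split => //; exists i.
have dB := @Baire R 'rV[R]_(nvar d) F (fun n => conj (oF n) (dF n)).
have [l [_ Hl]] := dB setT (ex_intro _ 0 I) openT.
have [n Hn] := HP l; have [i [ni]] := Hl n I.
by rewrite Hn // eqxx.
Qed.

End SmoothEvaluation.

(** * Local trivializations of the dual algebra bundle *)


Lemma Ck_local (R : realType) (V W : normedModType R) k (O : set V) (f : V -> W) :
  (forall x, O x -> exists P, [/\ open P, P x & Ck k P f]) -> Ck k O f.
Proof.
elim: k f => [|k IH] f H.
  by move=> x /H[P [_ Px fP]]; exact: fP.
split=> [x /H[P [_ Px [df _]]]|v]; first exact: df.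
by apply: IH => x /H[P [oP Px [_ Hd]]]; exists P; split => //; exact: Hd.
Qed.

(** Smoothness in charts yields a representative that depends on the point; it agrees with g on an
    open set, and being C^k is a local property. *)
Lemma smooth_Euc_Cinfty (R : realType) n (g : EucC R n -> realC R) :
  smooth g -> Cinfty setT (g : 'rV[R]_n -> R).
Proof.
move=> sg k; apply: Ck_local => x _.
have [_ /(_ _ _ (erefl _) (erefl _) I I)[ O [h [oO Ox Hh Eh]]]] := sg x I.
have [P [oP Px PE]] : exists P, [/\ open P, P x &
    P `<=` [set q | const_mx (g q) = h q]].
  exists (interior [set q : 'rV[R]_n | const_mx (g q) = h q]).
  by split; [exact: open_interior|exact: Eh|exact: interior_subset].
exists (O `&` P); split => //; first exact: openI.
apply: (@Ck_ext _ _ _ _ _ (fun q => h q 0 0)); first exact: openI.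
  by move=> q [_ /PE <-]; rewrite mxE.
by apply: Ck_coord; [exact: openI|apply: Ck_sub (Hh k) => q []].
Qed.

(** The inverse inherits linearity and multiplicativity through the injectivity of f; only its
    degrees have to be checked. *)
Lemma galg_iso_can (R : realType) (A B : galg R) (f : A -> B) (g : B -> A) :
  galg_hom f -> cancel f g -> cancel g f ->
  (forall i b, gacomp i b -> gacomp i (g b)) -> galg_iso f.
Proof.
move=> hf fK gK hg; exists g; split => //; have [lf [f1 fM] _] := hf; split => //.
- by move=> k a b; apply: (can_inj fK); rewrite lf !gK.
- by split => [|a b]; apply: (can_inj fK); rewrite ?fM ?gK.
Qed.

Lemma surj_inv (T U : Type) (f : T -> U) : injective f ->
  (forall u, exists t, f t = u) -> exists2 g, cancel f g & cancel g f.
Proof.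
move=> fI /choice[g Hg]; exists g => // t; exact: fI.
Qed.

Lemma pev_sum (R : realType) d (l : 'rV[R]_(nvar d)) (I : Type) (r : seq I)
    (p : I -> polyA R d) : pev l (\sum_(i <- r) p i) = \sum_(i <- r) pev l (p i).
Proof. exact: raddf_sum. Qed.

Lemma coef_pev_wmexp (R : realType) d i (l : 'rV[R]_(nvar d)) (p : polyA R d) :
  (pev l p)`_i = \sum_(j < #|wmon d i|) mcoeff (wmexp j) p * monev (wmexp j) l.
Proof.
rewrite coef_pev (peval_homog _ (@pcomp_homog _ _ _ _)); apply: eq_bigr => j _.
by rewrite mcoeff_pcomp mwt_wmexp eqxx.
Qed.

(* The condition on (U, y, s) in [gb_locally_trivial]. *)
Definition local_triv (R : realType) (F : pregb R) (U : set (gbbase F))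
    (y : gbtot F -> EucC R (nvar (gbdim F)))
    (s : prodC (gbbase F) (EucC R (nvar (gbdim F))) -> gbtot F) : Prop :=
  [/\ open U,
      smooth_on (@gbproj R F @^-1` U) y /\ smooth_on [set z : prodC _ _ | U z.1] s,
      forall p, U (gbproj p) -> s (gbproj p, y p) = p,
      forall z, U z.1 -> gbproj (s z) = z.1 /\ y (s z) = z.2
    & forall (t : R) p k, U (gbproj p) ->
        y (gbact t p) 0 k = t ^+ wt k * y p 0 k].

Section StarTrivialization.
Variables (R : realType) (F : gb R).
Variables (U : set (gbbase F)) (y : gbtot F -> EucC R (nvar (gbdim F))).
Variable s : prodC (gbbase F) (EucC R (nvar (gbdim F))) -> gbtot F.
Hypothesis H : local_triv U y s.
Notation d := (gbdim F).

Lemma gb_proj_smooth : smooth (@gbproj R F).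
Proof. by have [_ _ _ [sp _] _] := gbP F. Qed.

Lemma gb_base_cover (x : gbbase F) : exists2 e, catlas (gbbase F) e & cdom e x.
Proof. by have [[_ [_ _ _ cov _]] _ _ _ _] := gbP F. Qed.

Lemma gb_tot_cover (p : gbtot F) : exists2 e, catlas (gbtot F) e & cdom e p.
Proof. by have [[[_ _ _ cov _] _] _ _ _ _] := gbP F. Qed.

Lemma gb_base_id : @smooth R (gbbase F) (gbbase F) id.
Proof. by have [[_ [_ _ _ _ sid]] _ _ _ _] := gbP F. Qed.

Lemma near_proj (O : set (gbbase F)) (p : gbtot F) : open O -> O (gbproj p) ->
  \forall z \near p, O (gbproj z).
Proof.
move=> oO Op; have [pc _] := gb_proj_smooth (p := p) I.
exact: (pc _ (open_nbhs_nbhs (conj oO Op))).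
Qed.

Lemma triv_dil t p : U (gbproj p) -> y (gbact t p) = dil t (y p).
Proof. by move=> Up; have [_ _ _ _ yd] := H; apply/rowP => k; rewrite yd // mxE. Qed.

Lemma fibreU x (q : fibre x) : U x -> U (gbproj (sval q)).
Proof. by rewrite (svalP q). Qed.

Lemma triv_fun_sm x (Ux : U x) (p : polyA R d) k :
  fibre_smooth (fun q : fibre x => trunc k (pev (y (sval q)) p)).
Proof.
(* The formula extends off the fibre because y is defined on all of F, and it is smooth over U. *)
move=> q; exists (fun z => trunc k (pev (y z) p)); split; last first.
  by apply: near_all => z r <-.
have [oU [sy _] _ _ _] := H.
apply: filterS (near_proj oU (fibreU q Ux)) => z Uz.
apply: smooth_at_row => j.
apply: (@smooth_at_ext _ _ (realC R) (fun z => peval (pcomp j p) (y z))).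
  by apply: near_all => w; rewrite mxE coef_pev.
by apply: smooth_at_peval; exact: sy.
Qed.

Lemma triv_fun_eq x (Ux : U x) (p : polyA R d) t (q : fibre x) :
  pev (y (sval (fibre_act t q))) p = epsact t (pev (y (sval q)) p).
Proof. by rewrite epsact_pev triv_dil //; exact: fibreU. Qed.

(** The value 0 outside U makes the map total, as [triv] demands; nothing is known about y there. *)
Definition triv_map (x : gbbase F) (p : polyA R d) : homG_galg x :=
  if pselect (U x) is left Ux then
    HomG (triv_fun_sm Ux p) (triv_fun_eq Ux p)
  else 0.

Lemma triv_mapE x p (q : fibre x) : U x -> triv_map x p q = pev (y (sval q)) p.
Proof. by rewrite /triv_map; case: pselect. Qed.

Lemma triv_point x (l : 'rV[R]_(nvar d)) : U x -> gbproj (s (x, l)) = x.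
Proof. by move=> Ux; have [_ _ _ /(_ (x, l) Ux)[]] := H. Qed.

Definition tpt x (Ux : U x) l : fibre x := exist _ (s (x, l)) (triv_point l Ux).

Lemma y_tpt x (Ux : U x) l : y (sval (tpt Ux l)) = l.
Proof. by have [_ _ _ /(_ (x, l) Ux)[]] := H. Qed.

Lemma tpt_y x (Ux : U x) (q : fibre x) : tpt Ux (y (sval q)) = q.
Proof.
apply: fibre_eq; have [_ _ sK _ _] := H.
by have := sK _ (fibreU q Ux); rewrite /= (svalP q).
Qed.

Lemma fibre_act_tpt x (Ux : U x) t l : fibre_act t (tpt Ux l) = tpt Ux (dil t l).
Proof.
by rewrite -[LHS](tpt_y Ux) [X in tpt Ux X](triv_dil t (fibreU (tpt Ux l) Ux)) y_tpt.
Qed.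

Lemma tpt_smooth x (Ux : U x) (l : EucC R (nvar d)) :
  smooth_at (fun l : EucC R (nvar d) => s (x, l)) l.
Proof.
have [_ [_ ss] _ _ _] := H.
apply: (@smooth_at_comp _ _ (prodC (gbbase F) (EucC R (nvar d))) _ (fun l => (x, l)) s).
- by apply: coverP; [exact: gb_base_cover|exact: coverE].
- by apply: smooth_at_pair; [exact: smooth_at_cst|exact: smooth_EucC_id].
- exact: ss.
Qed.

Lemma homG_coef_smooth x (Ux : U x) (a : homG x) i :
  smooth (fun l : EucC R (nvar d) => (a (tpt Ux l))`_i : realC R).
Proof.
move=> l _; have [g [sg ag]] := @homsm _ _ _ a i (tpt Ux l).
have [sc _] := tpt_smooth Ux l.
(* Near the point, g agrees on the fibre with the truncation of a, whose i.+1 entries end with the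
   coefficient of eps^i. *)
apply: (@smooth_at_ext _ (EucC R (nvar d)) (realC R)
  (fun l => (g (s (x, l)) : 'rV[R]_i.+1) 0 ord_max)).
  have : \forall l' \near l, forall r : fibre x, sval r = s (x, l') ->
    trunc i (a r) = g (s (x, l')) := sc _ ag.
  by apply: filterS => l' /(_ (tpt Ux l') erefl) <-; rewrite mxE.
apply: smooth_at_crd; apply: (@smooth_at_comp _ _ _ _ (fun l => s (x, l)) g).
- exact: gb_tot_cover.
- exact: tpt_smooth.
- exact: (nbhs_singleton sg).
Qed.

Lemma triv_map_surj x (a : homG_galg x) : U x -> exists p, triv_map x p = a.
Proof.
move=> Ux.
have /choice[P HP] : forall i, exists p : polyA R d, gacomp i p /\
    forall l, (a (tpt Ux l))`_i = peval p l.
  move=> i; have [|p ip pE] := homog_smooth_poly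
    (i := i) (smooth_Euc_Cinfty (homG_coef_smooth Ux a i)).
    by move=> t l; rewrite -fibre_act_tpt homeq coef_epsact.
  by exists p.
(* At a single point the value of a is a polynomial in eps, so P_i vanishes there once i reaches its
   size; the bound n is uniform in the point. *)
have [|n Hn] := peval_eventually0 (P := P).
  move=> l; exists (size (a (tpt Ux l) : {poly R})) => i ni.
  by have [_ <-] := HP i; rewrite nth_default.
exists (\sum_(i < n) P i); apply: homG_eq => q; rewrite triv_mapE //.
set l := y _; rewrite -(tpt_y Ux q); apply/polyP => j; rewrite -/l.
have [_ ->] := HP j; rewrite pev_sum coef_sum.
under eq_bigr => i _ do rewrite (pev_homog l (HP i).1) coefZ coefXn.
have [jn|nj] := ltnP j n.
  rewrite (bigD1 (Ordinal jn)) //= eqxx mulr1 big1 ?addr0 // => i ij.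
  suff -> : (j == i) = false by rewrite mulr0.
  by apply: contra_neqF ij => /eqP E; apply: val_inj.
rewrite Hn // big1 ?/peval ?meval0 // => i _.
by rewrite gtn_eqF ?mulr0 //; exact: leq_trans nj.
Qed.

Lemma triv_map_hom x : U x -> galg_hom (triv_map x).
Proof.
move=> Ux; split.
- move=> k p q; apply: homG_eq => r /=; rewrite !scale1r addr0 !triv_mapE //.
  by have [-> _ _] := pev_is_galg_hom (y (sval r)).
- split=> [|p q]; apply: homG_eq => r /=; rewrite !triv_mapE //.
    by have [_ [-> _] _] := pev_is_galg_hom (y (sval r)).
  by have [_ [_ ->] _] := pev_is_galg_hom (y (sval r)).
- move=> i p ip q; rewrite triv_mapE //.
  by have [_ _] := pev_is_galg_hom (y (sval q)); exact.
Qed.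

Lemma triv_map_inj x : U x -> injective (triv_map x).
Proof.
move=> Ux p q E; apply: pev_eq => l; rewrite -(y_tpt Ux l).
by rewrite -!triv_mapE // E.
Qed.

(** Every l is the coordinate vector of a point of the fibre, so the degree can be tested at all
    evaluations. *)
Lemma triv_map_reflect x i p : U x -> gacomp i (triv_map x p) -> gacomp i p.
Proof.
move=> Ux ip; apply: pev_homogP => l j ji; have [a] := ip (tpt Ux l).
by rewrite triv_mapE // y_tpt => ->; rewrite coefZ coefXn (negbTE ji) mulr0.
Qed.

Lemma triv_map_iso x : U x -> galg_iso (triv_map x).
Proof.
move=> Ux; have [g fK gK] := surj_inv (triv_map_inj Ux) (fun a => triv_map_surj a Ux).
apply: (galg_iso_can (triv_map_hom Ux) fK gK) => i b ib.
by apply: (triv_map_reflect Ux); rewrite gK.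
Qed.

End StarTrivialization.


(** * The dual of a graded bundle is a graded polynomial algebra bundle *)

Section StarIsAlgebraBundle.
Variables (R : realType) (F : gb R).

Lemma sect_funE (s : forall x : gbbase F, homG x) i (x : gbbase F) (q : fibre x) :
  sect_fun s i (sval q) = (s x q)`_i.
Proof. by case: q => p px /=; subst x. Qed.

Definition bundle_triv U y s (H : @local_triv R F U y s) :
    triv (fun x : gbbase F => homG_galg x) (gbdim F) :=
  Triv U (triv_map H).

(** From functions to coefficients: interpolate the values at the points s(x, v_k), which move
    smoothly with x. Conversely, the function is a sum of coefficients pulled back from the base
    times monomials in y. *)
Lemma bundle_triv_in U y s (H : @local_triv R F U y s) : star_triv (bundle_triv H).
Proof.
have [oU [sy ss] sK _ _] := H.
split => //= [x Ux|i O sig oO OU sigi]; first exact: triv_map_iso.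
split=> [sm|[c [sc sigE]]].
  have [N [v [b Hb]]] := coef_interpolation R (gbdim F) i.
  pose e j x := \sum_k b j k * sect_fun sig i (s (x, v k)).
  exists (fun x => \sum_(j < #|wmon (gbdim F) i|) e j x *: wmonX j); split=> [m x Ox|x Ox].
    have [mi|mi] := eqVneq (mwt m) i; last first.
      apply: (@smooth_at_ext _ _ (realC R) (fun=> 0)); last exact: smooth_at_cst.
      apply: near_all => z; apply/esym/eqP; apply: contraNT mi => mz.
      by apply/eqP; apply: sum_wmonX_homog mz.
    have [j Ej] := wmexp_surj mi.
    apply: (@smooth_at_ext _ _ (realC R) (e j)).
      by apply: near_all => z; rewrite -Ej mcoeff_sum_wmonX.
    apply: smooth_at_sumr => k; apply: smooth_at_mulr; first exact: smooth_at_cst.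
    apply: (@smooth_at_comp _ _ _ _ (fun x => s (x, v k)) (sect_fun sig i)).
    - exact: gb_tot_cover.
    - apply: (@smooth_at_comp _ _ (prodC (gbbase F) (EucC R (nvar (gbdim F)))) _
        (fun x => (x, v k)) s).
      + by apply: coverP; [exact: gb_base_cover|exact: coverE].
      + by apply: smooth_at_pair; [exact: gb_base_id|exact: smooth_at_cst].
      + by apply: ss; exact: OU.
    - by apply: sm; rewrite /= (triv_point H) //; exact: OU.
  have Ux := OU x Ox; have [p pE] := triv_map_surj H (sig x) Ux.
  have ip : gacomp i p by apply: (triv_map_reflect (H := H) Ux); rewrite pE; exact: sigi.
  rewrite -pE (homog_wmexp ip); congr (triv_map H x _); apply: eq_bigr => j _.
  congr (_ *: _); rewrite Hb //; apply: eq_bigr => k _; congr (_ * _).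
  rewrite (_ : s (x, v k) = sval (tpt H Ux (v k))) // sect_funE -pE triv_mapE // y_tpt.
  by rewrite (pev_homog _ ip) coefZ coefXn eqxx mulr1.
move=> p Op.
apply: (@smooth_at_ext _ _ (realC R) (fun p => \sum_(j < #|wmon (gbdim F) i|)
    mcoeff (wmexp j) (c (gbproj p)) * monev (wmexp j) (y p))).
  apply: filterS (near_proj oO Op) => z Oz.
  by rewrite /sect_fun sigE // triv_mapE ?coef_pev_wmexp //; exact: OU.
apply: smooth_at_sumr => j; apply: smooth_at_mulr.
  apply: (@smooth_at_comp _ (gbtot F) (gbbase F) (realC R) (@gbproj R F)
    (fun x => mcoeff (wmexp j) (c x))).
  - exact: gb_base_cover.
  - exact: gb_proj_smooth.
  - exact: sc.
by apply: smooth_at_monev; apply: sy; exact: OU.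
Qed.

Lemma gb_local_triv (x : gbbase F) : exists U y s, @local_triv R F U y s /\ U x.
Proof.
have [_ _ _ _ /(_ x)[U [y [s [[oU Ux] sm sK ys yd]]]]] := gbP F.
by exists U, y, s; split.
Qed.

Lemma linear_sum1_galg (A B : galg R) (f : A -> B) n (u : 'I_n -> A) : linear f ->
  f (\sum_i u i) = \sum_i f (u i).
Proof.
move=> lf; have := linear_sum_galg (fun=> 1) u lf.
rewrite (eq_bigr u (fun i _ => scale1r (u i))) => ->.
by apply: eq_bigr => i _; exact: scale1r.
Qed.

Lemma galg_iso_is_galg (A B : galg R) (f : A -> B) :
  galg_iso f -> is_galg A -> is_galg B.
Proof.
move=> [g [fK gK [lf [f1 fM] fd] [lg [g1 gM] gd]]] [hl h1 hM hdec hind]; split.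
- by move=> i k a b ia ib; rewrite -[_ + _]gK lg; apply/fd/hl; exact: gd.
- by rewrite -f1; exact: fd.
- by move=> i j a b ia jb; rewrite -[_ * _]gK gM; apply/fd/hM; exact: gd.
- move=> b; have [n [u [hu E]]] := hdec (g b).
  exists n, (fun i => f (u i)); split; first by move=> i; exact: fd.
  by rewrite -[b]gK E linear_sum1_galg.
- move=> n u hu u0 i ni.
  suff : g (u i) = 0.
    move=> /(congr1 f); rewrite gK => ->.
    by have := lf (-1) 0 0; rewrite !scaleN1r !addNr.
  apply: (hind n (fun i => g (u i))) => //; first by move=> j; exact: gd.
  have g0 : g 0 = 0 by have := lg (-1) 0 0; rewrite !scaleN1r !addNr.
  by rewrite -linear_sum1_galg // u0.
Qed.

(** Constant coefficients are smooth, so the equivalence in [star_triv] applies. The resulting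
    smoothness on F no longer mentions T, which makes it possible to pass to another
    trivialization. *)
Lemma sect_fun_const (T : triv (fun x : gbbase F => homG_galg x) (gbdim F)) i
    (O : set (gbbase F)) (p : polyA R (gbdim F)) : star_triv T -> gacomp i p ->
  open O -> O `<=` tdom T ->
  smooth_on (@gbproj R F @^-1` O) (sect_fun (fun x => tmap T x p) i).
Proof.
move=> [oT isoT HT] ip oO OT; apply/HT => //.
  by move=> x Ox; have [g [_ _ [_ _ hT] _]] := isoT x (OT x Ox); exact: hT.
by exists (fun=> p); split=> // m x _; exact: smooth_at_cst.
Qed.

Lemma star_is_gpab : is_gpab (star F).
Proof.
have [[_ mM] _ _ _ _] := gbP F; split => //=.
- move=> x; have [U [y [s [H Ux]]]] := gb_local_triv x.
  exact: galg_iso_is_galg (triv_map_iso H Ux) (polyA_is_galg _ _).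
- by move=> T [].
- move=> x; have [U [y [s [H Ux]]]] := gb_local_triv x.
  by exists (bundle_triv H) => //; exact: bundle_triv_in.
- move=> T T' i p ST ST' ip; have [oT isoT _] := ST; have [oT' _ HT'] := ST'.
  apply/(HT' i); first exact: openI.
  + by move=> x [].
  + by move=> x [Tx _]; have [g [_ _ [_ _ hT] _]] := isoT x Tx; exact: hT.
  have TT : tdom T `&` tdom T' `<=` tdom T by move=> x [].
  exact: (sect_fun_const ST ip (openI oT oT') TT).
Qed.

End StarIsAlgebraBundle.

(** * Pullback along morphisms of graded bundles *)


(** The coefficients of the images of the monomials form the matrix of f in degree i. The dual map
    is given by the same matrix acting on dual coordinates, so it is smooth when these coefficients
    are. *)
Lemma dual_smooth_sections (R : realType) (A B : pregpab R)
    (fb : pabase B -> pabase A) (f : forall x : pabase B, pafib (fb x) -> pafib x) i :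
  is_gpab A -> is_gpab B -> continuous fb -> (forall x, galg_hom (f x)) ->
  (forall S T (j : 'I_#|wmon (padim A) i|), patriv A S -> patriv B T ->
     smooth_section T (tdom T `&` fb @^-1` tdom S)
       (fun x => f x (tmap S (fb x) (wmonX j)))) ->
  dual_smooth f i.
Proof.
move=> [_ _ tA _ _] [mB gB tB _ _] fc hf Hs S T x0 AS BT Tx0 Sx0.
have [oS isoS] := tA S AS; have [oT isoT] := tB T BT.
have /choice [c Hc] := fun j => Hs S T j AS BT.
pose Z := prodC (pabase B) (EucC R #|wmon (padim B) i|).
exists (fun z : Z => \row_j \sum_l mcoeff (wmexp l) (c j z.1) *
  (z.2 : 'rV[R]__) 0 l); split.
  move=> v; apply: smooth_at_row => j.
  apply: (@smooth_at_ext _ _ (realC R) (fun z : Z => \sum_l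
    mcoeff (wmexp l) (c j z.1) * (z.2 : 'rV[R]__) 0 l)).
    by apply: near_all => z; rewrite mxE.
  apply: smooth_at_sumr => l; apply: smooth_at_mulr.
    apply: (@smooth_at_comp _ Z (pabase B) (realC R) fst
      (fun x => mcoeff (wmexp l) (c j x))).
    - by case: mB => _ _ _ cov _; exact: cov.
    - by apply: smooth_at_fst; exact: manifold_id.
    - by have [sc _] := Hc j; apply: sc.
  apply: (@smooth_at_crd _ Z _ snd).
  by apply: smooth_at_snd; exact: smooth_EucC_id.
have nST : \forall x \near x0, tdom T x /\ tdom S (fb x).
  apply: filterI; first exact: open_nbhs_nbhs.
  exact: (fc x0 _ (open_nbhs_nbhs (conj oS Sx0))).
apply: filterS nST => x [Tx Sx] eta Heta.
apply/rowP => j; rewrite !mxE.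
have [_ Ec] := Hc j; rewrite Ec //.
have [gS [_ SK [_ _ hS] _]] := isoS (fb x) Sx.
have [gT [TK _ [lT _ hT] [_ _ hgT]]] := isoT x Tx.
have [_ _ hfx] := hf x.
have ci : gacomp i (c j x).
  by rewrite -[c j x]TK -Ec //; apply/hgT/hfx/hS; exact: wmonX_comp.
rewrite {1}(homog_wmexp ci) linear_sum_galg //.
have [Hlin _ _ _ _] := gB x.
rewrite (dual_elt_sum (i := i)) //.
- by apply: eq_bigr => l _; rewrite mxE.
- exact: Hlin.
- exact: gacomp0.
- by move=> l; apply: hT; exact: wmonX_comp.
Qed.

Section StarMorphism.
Variables (R : realType) (F E : gb R) (f : gbmor F E).

(** The base map is the composite of the embedding of the base, f, and the projection of E. *)
Lemma gbmbase_smooth : smooth (gbmbase f).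
Proof.
have [_ _ _ [_ [iota [si pi _]]] _] := gbP F; have [sf _ pf] := gbmP f => x _.
apply: (@smooth_at_ext _ _ _ (fun x => gbproj (gbmtot f (iota x)))).
  by apply: near_all => z; rewrite pf pi.
apply: (@smooth_at_comp _ _ (gbtot E) _ (fun x => gbmtot f (iota x)) (@gbproj R E)).
- exact: gb_tot_cover.
- apply: (@smooth_at_comp _ _ _ _ iota (gbmtot f)); last 2 first.
  + exact: si.
  + exact: sf.
  exact: gb_tot_cover.
- exact: gb_proj_smooth.
Qed.

Lemma star_mor_hom x : galg_hom (@star_mor R F E f x).
Proof.
split.
- by move=> k a b; apply: homG_eq.
- by split => [|a b]; apply: homG_eq.
- by move=> i a ia q; exact: ia.
Qed.

Lemma star_mor_is_zak : @is_zak R (star E) (star F) (gbmbase f) (star_mor f).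
Proof.
have sfb := gbmbase_smooth.
have cfb : continuous (gbmbase f) by move=> x; have [] := sfb x I.
split => // [x|i]; first exact: star_mor_hom.
apply: dual_smooth_sections => //.
- exact: star_is_gpab.
- exact: star_is_gpab.
- exact: star_mor_hom.
move=> S T j ST TT; have [oS isoS _] := ST; have [oT _ HT] := TT.
have oST : open (tdom T `&` gbmbase f @^-1` tdom S).
  by apply: openI => //; apply: open_comp => // x _; exact: cfb.
apply/(HT i) => //.
- move=> x [_ Sx]; have [g [_ _ [_ _ hS] _]] := isoS _ Sx.
  have [_ _ h] := star_mor_hom x; apply/h/hS; exact: wmonX_comp.
move=> p [_ /= Sp].
have [sf _ pf] := gbmP f.
apply: (@smooth_at_ext _ _ (realC R)
  (fun p => sect_fun (fun y => tmap S y (wmonX j)) i (gbmtot f p))).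
  apply: near_all => z; rewrite {2}/sect_fun /=.
  (* [fibre_map] proves membership in the fibre over [gbmbase f (gbproj z)], whereas [sect_fun] uses
     the fibre over [gbproj (gbmtot f z)]; [sect_funE] passes from one to the other. *)
  rewrite -(sect_funE (fun y => tmap S y (wmonX j)) i (fibre_map f (exist _ z erefl))) /=.
  by [].
apply: (@smooth_at_comp _ _ (gbtot E) (realC R) (gbmtot f)
  (sect_fun (fun y => tmap S y (wmonX j)) i)).
- exact: gb_tot_cover.
- exact: sf.
- apply: (sect_fun_const ST (@wmonX_comp R _ i j) oS (@subset_refl _ _)).
  by rewrite /= pf.
Qed.

End StarMorphism.

(** * The graded bundle of an algebra bundle *)


Lemma image_countable (T U : Type) (f : T -> U) (A : set T) :
  countable A -> countable (f @` A).
Proof. exact: card_le_trans (card_image_le _ _). Qed.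

Lemma second_countable_rV (R : realType) n : @second_countable 'rV[R]_n.
Proof.
pose f (u : 'rV[rat]_n * nat) : set 'rV[R]_n := ball (map_mx ratr u.1 : 'rV[R]_n) u.2.+1%:R^-1.
exists (f @` setT); first exact/image_countable/countableP.
split=> [_ [u _ <-]|x V /nbhs_ballP[e /= e0 eV]]; first exact: ball_open.
(* A ball of radius below e / 2 that contains x lies in the ball of radius e around x. *)
have [//|k] := @ltr_add_invr R 0 (e / 2) _; first by rewrite divr_gt0.
rewrite add0r => ke; set r : R := k.+1%:R^-1 in ke.
have r0 : 0 < r by rewrite invr_gt0 ltr0n.
have /choice[q Hq] : forall j, exists q : rat, `|ratr q - x 0 j| < r.
  move=> j; have [|q] := @rat_in_itvoo R (x 0 j - r) (x 0 j + r).
    by rewrite ltrBlDr -addrA ltrDl addr_gt0.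
  rewrite in_itv /= => /andP[q1 q2]; exists q.
  by rewrite ltr_norml ltrBrDl q1 ltrBlDl q2.
exists (f (\row_j q j, k)).
  split; first by exists (\row_j q j, k).
  by split => // i j; rewrite !mxE (ord1 i); exact: Hq.
move=> z [_ fz]; apply: eV; split => // i j; rewrite /= -/r in fz.
rewrite (ord1 i) /ball /=; have := fz 0 j; have := Hq j.
rewrite !mxE /ball /= distrC => H1 H2.
apply: (le_lt_trans (ler_distD (ratr (q j)) _ _)).
by rewrite [e]splitr ltrD // (lt_trans _ ke).
Qed.

Lemma cluster_continuous (T U : topologicalType) (g : T -> U) (p q : T) :
  {for p, continuous g} -> {for q, continuous g} ->
  cluster (nbhs p) q -> cluster (nbhs (g p)) (g q).
Proof.
move=> gp gq H A B /gp Ap /gq Bq; have [z [Az Bz]] := H _ _ Ap Bq.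
by exists (g z).
Qed.

Section CostarManifold.
Variables (R : realType) (A : gpab R).
Notation M := (pabase A).
Notation d := (padim A).
Notation n := (nvar d).
Notation X := (costar_charted A).
Implicit Types (z : costar_tot A) (T : triv (@pafib R A) (padim A)).

Definition ccrd T z : M * 'rV[R]_n := (costar_proj z, costar_coord T z).

Lemma gpab_open T : patriv A T -> open (tdom T).
Proof. by have [_ _ tA _ _] := gpabP A => /tA[]. Qed.

Lemma gpab_iso T x : patriv A T -> tdom T x -> galg_iso (tmap T x).
Proof. by have [_ _ tA _ _] := gpabP A => /tA[_]; exact. Qed.

Lemma gpab_cover (x : M) : exists2 T, patriv A T & tdom T x.
Proof. by have [_ _ _ cov _] := gpabP A. Qed.

Lemma gpab_manifold : is_manifold M.
Proof. by have [] := gpabP A. Qed.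

Lemma gpab_base_cover (x : M) : exists2 c, catlas M c & cdom c x.
Proof. by have [_ _ _ cov _] := gpab_manifold. Qed.

Lemma costar_pev T z p : patriv A T -> tdom T (costar_proj z) ->
  sval (projT2 z) (tmap T (costar_proj z) p) = pev (costar_coord T z) p.
Proof.
move=> AT Tz; have [g [_ _ hT _]] := gpab_iso AT Tz.
exact: (galg_hom_pev (galg_hom_comp hT (svalP (projT2 z)))).
Qed.

Lemma costar_ext T z z' : patriv A T -> tdom T (costar_proj z) ->
  ccrd T z = ccrd T z' -> z = z'.
Proof.
case: z z' => [x u] [x' u'] AT Tx [/= xx']; subst x' => E.
apply: costar_tot_eq => a; have [g [_ gK _ _]] := gpab_iso AT Tx.
rewrite -(gK a).
have /= -> := costar_pev (z := existT _ x u) (g a) AT Tx.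
by have /= -> := costar_pev (z := existT _ x u') (g a) AT Tx; rewrite E.
Qed.

Lemma costar_point T x (l : 'rV[R]_n) : patriv A T -> tdom T x ->
  exists z, ccrd T z = (x, l).
Proof.
move=> AT Tx; have [g [gK _ _ hg]] := gpab_iso AT Tx.
exists (existT _ x (exist _ (fun a => pev l (g a))
  (galg_hom_comp hg (pev_is_galg_hom l)))).
congr (_, _); apply/rowP => k; rewrite mxE /= gK pevX coefZ coefXn eqxx.
exact: mulr1.
Qed.

(** Write the k-th generator of T in T': a polynomial of weight wt k with smooth coefficients.
    Applying z evaluates it at the T'-coordinates of z and yields the k-th T-coordinate. *)
Lemma costar_transition T T' : patriv A T -> patriv A T' ->
  exists tau : prodC M (EucC R n) -> EucC R n,
    (forall w, (tdom T `&` tdom T') w.1 -> smooth_at tau w) /\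
    forall z, (tdom T `&` tdom T') (costar_proj z) ->
      costar_coord T z = tau (ccrd T' z).
Proof.
move=> AT AT'; have [_ _ _ _ trA] := gpabP A.
have /choice[c Hc] : forall k : 'I_n, exists c : M -> polyA R d,
    (forall m, @smooth_on R M (realC R) (tdom T `&` tdom T') (fun x => mcoeff m (c x))) /\
    (forall x, (tdom T `&` tdom T') x -> tmap T x (polyX k) = tmap T' x (c x)).
  by move=> k; apply: (trA T T' (wt k)) => //; exact: polyX_homog.
exists (fun w => \row_k \sum_(j < #|wmon d (wt k)|)
  mcoeff (wmexp j) (c k w.1) * monev (wmexp j) w.2); split=> [w Ow|z Oz].
  apply: smooth_at_row => k.
  apply: (@smooth_at_ext _ _ (realC R) (fun w : prodC M (EucC R n) =>
    \sum_(j < #|wmon d (wt k)|) mcoeff (wmexp j) (c k w.1) * monev (wmexp j) w.2)).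
    by apply: near_all => w'; rewrite mxE.
  apply: smooth_at_sumr => j; apply: smooth_at_mulr.
    apply: (@smooth_at_comp _ (prodC M (EucC R n)) M (realC R) fst
      (fun x => mcoeff (wmexp j) (c k x))).
    - exact: gpab_base_cover.
    - by apply: smooth_at_fst; exact: manifold_id gpab_manifold.
    - by have [sc _] := Hc k; exact: sc.
  by apply: smooth_at_monev; apply: smooth_at_snd; exact: smooth_EucC_id.
apply/rowP => k; rewrite !mxE; have [_ ->] := Hc k; last exact: Oz.
by case: Oz => Tz T'z; rewrite costar_pev // coef_pev_wmexp.
Qed.

(** Openness is defined through all trivializations; since the transition maps are continuous,
    neighbourhoods can be tested in a single one. *)
Lemma costar_nbhs T z (P : set (costar_tot A)) : patriv A T -> tdom T (costar_proj z) ->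
  (nbhs z P <-> \forall w \near ccrd T z, forall z', ccrd T z' = w -> P z').
Proof.
move=> AT Tz; split=> [|].
  rewrite nbhsE => -[Q [oQ Qz] QP].
  have cQ : costar_open Q by exact: oQ.
  by apply: filterS (cQ T z AT Tz Qz) => w Hw z' /Hw; exact: QP.
move=> [[N1 N2] /= [N1z N2z] HN].
rewrite nbhsE; exists [set z' | [/\ tdom T (costar_proj z'),
    interior N1 (costar_proj z') & interior N2 (costar_coord T z')]]; last first.
  move=> z' [_ N1z' N2z']; apply: (HN (ccrd T z')) => //.
  by split; exact: interior_subset.
split; last by split.
suff : costar_open [set z' | [/\ tdom T (costar_proj z'),
    interior N1 (costar_proj z') & interior N2 (costar_coord T z')]] by [].
move=> T' z1 AT' T'z1 [Tz1 N1z1 N2z1].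
have [tau [stau Etau]] := costar_transition AT AT'.
have [tc _] := stau (ccrd T' z1) (conj Tz1 T'z1).
have n1 : \forall w \near ccrd T' z1, (tdom T `&` tdom T' `&` interior N1) w.1.
  apply: (cvg_fst (F := nbhs (costar_proj z1))).
  apply: open_nbhs_nbhs; split=> //; apply: openI; last exact: open_interior.
  by apply: openI; exact: gpab_open.
have n2 : \forall w \near ccrd T' z1, interior N2 (tau w).
  apply: tc; apply: open_nbhs_nbhs; split; first exact: open_interior.
  by rewrite -Etau.
apply: filterS2 n1 n2 => w [[Tw T'w] N1w] N2w z' Ew.
move: Tw T'w N1w N2w; rewrite -Ew /= => Tw T'w N1w.
by rewrite -Etau //; split.
Qed.

End CostarManifold.


Lemma continuous_row_mx (R : realType) (T : topologicalType) m n
    (f : T -> 'rV[R]_m) (g : T -> 'rV[R]_n) (p : T) :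
  {for p, continuous f} -> {for p, continuous g} ->
  {for p, continuous (fun x => row_mx (f x) (g x))}.
Proof.
move=> fc gc.
rewrite (_ : (fun x => row_mx (f x) (g x)) =
    fun x => f x *m row_mx 1%:M 0 + g x *m row_mx 0 1%:M); last first.
  apply/funext => x.
  by rewrite !mul_mx_row !mulmx1 !mulmx0 add_row_mx addr0 add0r.
apply: cvgD.
- exact: (continuous_comp fc (@lin_row_continuous R m (m + n) (mulmxr (row_mx 1%:M 0)) (f p))).
- exact: (continuous_comp gc (@lin_row_continuous R n (m + n) (mulmxr (row_mx 0 1%:M)) (g p))).
Qed.

(** * The manifold structure of the total space *)

Section CostarBundle.
Variables (R : realType) (A : gpab R).
Notation M := (pabase A).
Notation d := (padim A).
Notation n := (nvar d).
Notation X := (costar_charted A).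
Implicit Types (z : costar_tot A) (T : triv (@pafib R A) (padim A)).

Lemma ccrd_continuous T z : patriv A T -> tdom T (costar_proj z) ->
  {for z, continuous (ccrd T)}.
Proof.
move=> AT Tz W zW; apply/(costar_nbhs _ AT Tz).
by apply: filterS zW => w Ww z' Ew; rewrite /= Ew.
Qed.

Lemma costar_proj_continuous z : {for z, continuous (@costar_proj R A)}.
Proof.
have [T AT Tz] := gpab_cover (costar_proj z).
exact: (@continuous_comp _ _ _ (ccrd T) fst z (ccrd_continuous AT Tz) cvg_fst).
Qed.

Lemma near_costar T z : patriv A T -> tdom T (costar_proj z) ->
  \forall z' \near z, tdom T (costar_proj z').
Proof.
move=> AT Tz; apply: (costar_proj_continuous (z := z)).
by apply: open_nbhs_nbhs; split => //; exact: gpab_open.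
Qed.

Lemma costar_continuous (Y : topologicalType) (g : Y -> costar_tot A) (p : Y) T :
  patriv A T -> tdom T (costar_proj (g p)) ->
  {for p, continuous (fun q => costar_proj (g q))} ->
  {for p, continuous (fun q => costar_coord T (g q) : 'rV[R]_n)} ->
  {for p, continuous g}.
Proof.
move=> AT Tp c1 c2 P /(costar_nbhs _ AT Tp) HP.
have c : {for p, continuous (fun q => ccrd T (g q))} by exact: cvg_pair c1 c2.
have Hq : \forall q \near p, forall z', ccrd T z' = ccrd T (g q) -> P z' := c _ HP.
suff : \forall q \near p, P (g q) by [].
by apply: filterS Hq => q; exact.
Qed.

(** A chart of the target may come from another trivialization T', whose coordinates are a smooth
    function of those of T. *)
Lemma smooth_into_costar (Y : charted R) (g : Y -> X) (p : Y) T :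
  patriv A T -> tdom T (costar_proj (g p)) ->
  @smooth_at R Y M (fun q => costar_proj (g q)) p ->
  @smooth_at R Y (EucC R n) (fun q => costar_coord T (g q)) p ->
  smooth_at g p.
Proof.
move=> AT Tp s1 s2.
have gc : {for p, continuous g}.
  by apply: (costar_continuous AT Tp); [case: s1|case: s2].
split => // c _ Yc [T' [e [AT' Me ->]]] cp [/= T'p ep].
have [tau [stau Etau]] := costar_transition AT' AT.
have s3 : @smooth_at R Y (EucC R n) (fun q => costar_coord T' (g q)) p.
  apply: (@smooth_at_ext _ _ (EucC R n) (fun q => tau (costar_proj (g q), costar_coord T (g q)))).
    have n1 : \forall q \near p, tdom T (costar_proj (g q)) := gc _ (near_costar AT Tp).
    have n2 : \forall q \near p, tdom T' (costar_proj (g q)) := gc _ (near_costar AT' T'p).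
    by apply: filterS2 n1 n2 => q Tq T'q; rewrite (Etau (g q)).
  apply: (@smooth_at_comp _ Y (prodC M (EucC R n)) (EucC R n)
    (fun q => (costar_proj (g q), costar_coord T (g q))) tau).
  - by apply: coverP; [exact: gpab_base_cover|exact: coverE].
  - exact: smooth_at_pair.
  - exact: stau.
have [_ Hp] := smooth_at_pair s1 s3.
(* After passing to coordinates, a chart of the total space is this chart of M x R^n. *)
have Me' : catlas (prodC M (EucC R n)) (@prod_chart R M (EucC R n) e (Chart setT id)).
  by exists e, (Chart setT id).
exact: (Hp c _ Yc Me' cp (conj ep I)).
Qed.

Lemma smooth_from_costar (Y : charted R) (g : X -> Y) z :
  (forall T, patriv A T -> tdom T (costar_proj z) ->
     exists G : prodC M (EucC R n) -> Y, smooth_at G (ccrd T z) /\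
       \forall z' \near z, g z' = G (ccrd T z')) -> smooth_at g z.
Proof.
move=> H; split.
  have [T AT Tz] := gpab_cover (costar_proj z).
  have [G [[Gc _] EG]] := H T AT Tz.
  have gz := nbhs_singleton EG; rewrite /prop_for /continuous_at gz.
  have EG' : \forall z' \near z, G (ccrd T z') = g z' by apply: filterS EG => z' ->.
  have Gcc : {for z, continuous (fun z' => G (ccrd T z'))}.
    exact: (continuous_comp (ccrd_continuous AT Tz) Gc).
  exact: cvg_trans (near_eq_cvg EG') Gcc.
move=> _ e [T [c [AT Mc ->]]] Ye [/= Tz cz] ez.
have [G [[Gc HG] EG]] := H T AT Tz.
have gz := nbhs_singleton EG; rewrite gz in ez.
have Mc' : catlas (prodC M (EucC R n)) (@prod_chart R M (EucC R n) c (Chart setT id)).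
  by exists c, (Chart setT id).
have [ O [h [oO Oz Hh Eh]]] := HG _ e Mc' Ye (conj cz I) ez.
exists O, h; split => //.
have Eh' := ccrd_continuous AT Tz Eh.
by apply: filterS2 EG Eh' => z' -> /= ->.
Qed.

Lemma costar_proj_smooth : @smooth R X M (@costar_proj R A).
Proof.
move=> z _; apply: smooth_from_costar => T AT Tz; exists fst; split.
  by apply: smooth_at_fst; exact: manifold_id (gpab_manifold A).
exact: near_all.
Qed.

Lemma costar_coord_smooth T z : patriv A T -> tdom T (costar_proj z) ->
  @smooth_at R X (EucC R n) (costar_coord T) z.
Proof.
move=> AT Tz; apply: smooth_from_costar => T' AT' T'z.
have [tau [stau Etau]] := costar_transition AT AT'.
exists tau; split; first exact: stau.
by apply: filterS2 (near_costar AT Tz) (near_costar AT' T'z) => z' Tz' T'z'; exact: Etau.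
Qed.

(** Points that cannot be separated lie in one fibre, as M is Hausdorff; then one trivialization
    covers both and their coordinates agree. *)
Lemma costar_hausdorff : hausdorff_space X.
Proof.
have [hM _ _ _ _] := gpab_manifold A.
move=> z z' zz'; have [T AT Tz] := gpab_cover (costar_proj z).
have Ep : costar_proj z = costar_proj z'.
  by apply: hM; apply: cluster_continuous zz'; exact: costar_proj_continuous.
have Tz' : tdom T (costar_proj z') by rewrite -Ep.
apply: (costar_ext AT Tz); congr (_, _) => //.
apply: (@norm_hausdorff _ 'rV[R]_n); apply: cluster_continuous zz'.
  exact: (@continuous_comp _ _ _ (ccrd T) snd z (ccrd_continuous AT Tz) cvg_snd).
exact: (@continuous_comp _ _ _ (ccrd T) snd z' (ccrd_continuous AT Tz') cvg_snd).
Qed.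

Lemma costar_second_countable : @second_countable X.
Proof.
have [_ [B cB [oB bB]] _ _ _] := gpab_manifold A.
have [C cC [oC bC]] := second_countable_rV R n.
(* There may be uncountably many trivializations, so one is chosen for each basic open set b
   contained in the domain of some. The trivialization with empty domain is a placeholder for the
   other b. *)
have /choice[t Ht] : forall b : set M, exists T, (exists T', patriv A T' /\ b `<=` tdom T') ->
    patriv A T /\ b `<=` tdom T.
  move=> b; have [[T HT]|H] := pselect (exists T', patriv A T' /\ b `<=` tdom T').
    by exists T.
  by exists (Triv set0 (fun _ _ => 0)).
(* In w = (b, b', c), b only selects the trivialization t b, and b' is the
   neighbourhood in the base. *)
pose O (w : set M * set M * set 'rV[R]_n) : set X := [set z |
  [/\ tdom (t w.1.1) (costar_proj z), w.1.2 (costar_proj z) &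
      w.2 (costar_coord (t w.1.1) z)]].
pose D : set (set M * set M * set 'rV[R]_n) :=
  ((B `*` B) `*` C) `&` [set w | patriv A (t w.1.1)].
exists (O @` D).
  apply: image_countable; apply: (sub_countable (B := (B `*` B) `*` C)).
    by apply: subset_card_le; exact: subIsetl.
  by apply: countableX => //; exact: countableX.
split.
  move=> _ [[[b b'] c] [[[/= Bb Bb'] Cc] At] <-].
  rewrite openE => z [/= Tz b'z cz]; apply/(costar_nbhs _ At Tz).
  have n1 : \forall w \near ccrd (t b) z, (tdom (t b) `&` b') w.1.
    apply: (cvg_fst (F := nbhs (costar_proj z))); apply: open_nbhs_nbhs; split => //.
    by apply: openI; [exact: gpab_open|exact: oB].
  have n2 : \forall w \near ccrd (t b) z, c w.2.
    apply: (cvg_snd (G := nbhs (costar_coord (t b) z))); apply: open_nbhs_nbhs; split => //.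
    exact: oC.
  by apply: filterS2 n1 n2 => w + + z' Ew; rewrite -Ew /= => -[Tz' bz'] cz'; split.
move=> z P zP; have [T AT Tz] := gpab_cover (costar_proj z).
have [b [Bb bz] bT] := bB _ _ (open_nbhs_nbhs (conj (gpab_open AT) Tz)).
have [At bt] := Ht b (ex_intro _ T (conj AT bT)).
have tz := bt _ bz.
have [[N1 N2] /= [N1z N2z] HN] := (costar_nbhs P At tz).1 zP.
have [b' [Bb' b'z] b'N] := bB _ _ N1z.
have [c [Cc cz] cN] := bC _ _ N2z.
exists (O (b, b', c)); first by split => //; exists (b, b', c).
move=> z' [/= Tz' b'z' cz']; apply: (HN (ccrd (t b) z')) => //.
by split; [exact: b'N|exact: cN].
Qed.

Lemma costar_is_chart T (c : chart R M (cdim M)) : patriv A T -> catlas M c ->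
  is_chart (costar_chart T c : chart R X (cdim X)).
Proof.
move=> AT Mc; have [_ _ /(_ c Mc)[oc cc ci co] _ _] := gpab_manifold A.
split.
- rewrite openE => z [Tz cz]; apply: filterI; first exact: near_costar.
  by apply: (costar_proj_continuous (z := z)); exact: open_nbhs_nbhs.
- move=> z [Tz cz].
  apply: continuous_row_mx; last first.
    exact: (@continuous_comp _ _ _ (ccrd T) snd z (ccrd_continuous AT Tz) cvg_snd).
  exact: (@continuous_comp _ _ _ (@costar_proj R A) c z (@costar_proj_continuous z) (cc _ cz)).
- move=> z z' [Tz cz] [Tz' cz'] /= /eq_row_mx[/(ci _ _ cz cz') E1 E2].
  by apply: (costar_ext AT Tz); congr (_, _).
- move=> O oO OD; rewrite openE => _ [z Oz <-].
  have [Tz cz] := OD z Oz.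
  have [[N1 N2] /= [N1z N2z] HN] := (costar_nbhs _ AT Tz).1 (open_nbhs_nbhs (conj oO Oz)).
  (* Restricted to the domain of c, so that the image under c is open, and to that of T, so that
     [costar_point] applies. *)
  pose P := interior N1 `&` (tdom T `&` cdom c).
  have oP : open P.
    by apply: openI; [exact: open_interior|apply: openI => //; exact: gpab_open].
  have ocP : open (c @` P) by apply: co => // x [_ []].
  have n1 : \forall u \near (row_mx (c (costar_proj z)) (costar_coord T z) : 'rV[R]_(_ + _)),
      (c @` P) (lsubmx u).
    apply: (@lin_row_continuous R (cdim M + n) (cdim M) (@lsubmx R 1 (cdim M) n) _).
    rewrite /= row_mxKl.
    by apply: open_nbhs_nbhs; split => //; exists (costar_proj z).
  have n2 : \forall u \near (row_mx (c (costar_proj z)) (costar_coord T z) : 'rV[R]_(_ + _)),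
      N2 (rsubmx u).
    apply: (@lin_row_continuous R (cdim M + n) n (@rsubmx R 1 (cdim M) n) _).
    by rewrite /= row_mxKr.
  apply: filterS2 n1 n2 => u [x [N1x [Tx cx]] xu] N2u.
  have [z' Ez'] := costar_point (rsubmx u) AT Tx.
  exists z'.
    by apply: (HN (x, rsubmx u)) => //; split => //=; exact: interior_subset.
  by case: Ez' => /= -> ->; rewrite xu hsubmxK.
Qed.

Lemma costar_manifold : is_manifold X.
Proof.
split.
- exact: costar_hausdorff.
- exact: costar_second_countable.
- by move=> _ [T [c [AT Mc ->]]]; exact: costar_is_chart.
- move=> z; have [T AT Tz] := gpab_cover (costar_proj z).
  have [c Mc cz] := gpab_base_cover (costar_proj z).
  by exists (costar_chart T c) => //; exists T, c.
- move=> z _; have [T AT Tz] := gpab_cover (costar_proj z).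
  apply: (smooth_into_costar AT Tz); first exact: costar_proj_smooth.
  exact: costar_coord_smooth.
Qed.

End CostarBundle.


Lemma smooth_realC_id (R : realType) : @smooth R (realC R) (realC R) id.
Proof.
move=> x _; split; first exact: cvg_id.
move=> c e -> -> _ _; exists setT, id; split => //; first exact: openT.
  by move=> j; exact: (@Ck_lin _ _ _ _ setT idfun openT).
exact: near_all.
Qed.

(** * Action, base and local triviality *)

Section CostarGradedBundle.
Variables (R : realType) (A : gpab R).
Notation M := (pabase A).
Notation d := (padim A).
Notation n := (nvar d).
Notation X := (costar_charted A).
Implicit Types (z : costar_tot A) (T : triv (@pafib R A) (padim A)).

Lemma costar_coord_act T t z : costar_coord T (costar_act t z) = dil t (costar_coord T z).
Proof. by apply/rowP => k; rewrite !mxE coef_epsact. Qed.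

Lemma costar_local_triv T x : patriv A T -> tdom T x ->
  exists s, @local_triv R (costar A) (tdom T) (costar_coord T) s.
Proof.
(* z0 is a witness for pairs over points outside [tdom T], where the condition on s is vacuous. *)
move=> AT Tx; have [z0 _] := costar_point 0 AT Tx.
have /choice[s Hs] : forall w : M * 'rV[R]_n, exists z : X, tdom T w.1 -> ccrd T z = w.
  move=> [x' l]; have [Tx'|Tx'] := pselect (tdom T x').
    by have [z Ez] := costar_point l AT Tx'; exists z.
  by exists z0.
have sp w : tdom T w.1 -> costar_proj (s w) = w.1 by move=> /Hs/(congr1 fst).
have sc w : tdom T w.1 -> costar_coord T (s w) = w.2 by move=> /Hs/(congr1 snd).
have near_w (w : prodC M (EucC R n)) : tdom T w.1 -> \forall w' \near w, tdom T w'.1.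
  move=> Tw; apply: (cvg_fst (F := nbhs w.1)); apply: open_nbhs_nbhs; split => //.
  exact: gpab_open.
exists s; split.
- exact: gpab_open.
- split=> [z Tz|w Tw]; first exact: costar_coord_smooth.
  have Tw' := near_w w Tw.
  apply: (smooth_into_costar AT); first by rewrite sp.
    apply: (@smooth_at_ext R (prodC M (EucC R n)) M fst (fun w => costar_proj (s w))).
      by apply: filterS Tw' => w' Tw'; rewrite sp.
    by apply: smooth_at_fst; exact: manifold_id (gpab_manifold A).
  apply: (@smooth_at_ext R (prodC M (EucC R n)) (EucC R n) snd
    (fun w => costar_coord T (s w))).
    by apply: filterS Tw' => w' Tw'; rewrite sc.
  by apply: smooth_at_snd; exact: smooth_EucC_id.
- move=> z Tz; apply: (costar_ext AT); rewrite ?sp // /ccrd.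
  by rewrite sp // sc.
- by move=> w Tw; split; [exact: sp|exact: sc].
- by move=> t z k Tz; rewrite costar_coord_act mxE.
Qed.

Lemma costar_act_smooth :
  @smooth R (prodC (realC R) X) X (fun tz => costar_act tz.1 tz.2).
Proof.
move=> [t z] _; have [T AT Tz] := gpab_cover (costar_proj z).
have sX : smooth_at (fun tz : prodC (realC R) X => tz.2) (t, z).
  by apply: smooth_at_snd; exact: manifold_id (costar_manifold A).
have covX := let: And5 _ _ _ cov _ := costar_manifold A in cov.
apply: (smooth_into_costar AT); first exact: Tz.
  apply: (@smooth_at_comp _ (prodC (realC R) X) X M (fun tz => tz.2) (@costar_proj R A)) => //.
  exact: costar_proj_smooth.
apply: (@smooth_at_ext _ (prodC (realC R) X) (EucC R n)
  (fun tz => dil tz.1 (costar_coord T tz.2))).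
  by apply: near_all => w; rewrite costar_coord_act.
apply: smooth_at_row => k.
apply: (@smooth_at_ext _ (prodC (realC R) X) (realC R)
  (fun tz => tz.1 ^+ wt k * (costar_coord T tz.2 : 'rV[R]_n) 0 k)).
  by apply: near_all => w; rewrite [RHS]mxE.
apply: smooth_at_mulr.
  apply: smooth_at_exp; apply: smooth_at_fst; exact: smooth_realC_id.
apply: (@smooth_at_crd R (prodC (realC R) X) n
  (fun tz : prodC (realC R) X => costar_coord T tz.2) k).
apply: (@smooth_at_comp _ (prodC (realC R) X) X (EucC R n) (fun tz => tz.2)
  (costar_coord T)) => //.
exact: costar_coord_smooth.
Qed.


(** Weights are positive, so h_0 makes every coordinate zero and only the base point remains. *)
Lemma costar_act0 z z' : costar_proj z = costar_proj z' ->
  costar_act 0 z = costar_act 0 z' :> X.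
Proof.
move=> E; have [T AT Tz] := gpab_cover (costar_proj z).
apply: (costar_ext AT) => //; congr (_, _) => //.
by rewrite !costar_coord_act; apply/rowP => k; rewrite !mxE exprS !mul0r.
Qed.

Lemma costar_inhab (x : M) : exists z, costar_proj z = x.
Proof.
have [T AT Tx] := gpab_cover x.
by have [z [Ez _]] := costar_point 0 AT Tx; exists z.
Qed.

Lemma costar_gb_base : gb_base (costar A).
Proof.
split; first exact: costar_proj_smooth.
have /choice[e He] := costar_inhab.
(* The chosen e need not be continuous; h_0 turns it into the zero section, whose coordinates vanish
   in every trivialization. *)
exists (fun x => costar_act 0 (e x)); split=> [x _|x|z].
- have [T AT Tx] := gpab_cover x.
  apply: (smooth_into_costar AT); first by rewrite (_ : costar_proj _ = x) //; exact: He.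
    apply: (@smooth_at_ext _ _ M id); first by apply: near_all => y; exact: esym (He y).
    exact: manifold_id (gpab_manifold A) _ I.
  apply: (@smooth_at_ext _ _ (EucC R n) (fun=> 0)); last exact: smooth_at_cst.
  apply: near_all => y; rewrite costar_coord_act; apply/rowP => k.
  by rewrite !mxE exprS !mul0r.
- exact: He.
- by apply: costar_act0; exact: He.
Qed.

Lemma costar_actM t s z : costar_act t (costar_act s z) = costar_act (t * s) z :> X.
Proof. by case: z => x u; apply: costar_tot_eq => a; exact: epsactM. Qed.

Lemma costar_act1 z : costar_act 1 z = z :> X.
Proof. by case: z => x u; apply: costar_tot_eq => a; exact: epsact1. Qed.

Lemma costar_is_gb : is_gb (costar A).
Proof.
split.
- by split; [exact: costar_manifold|exact: gpab_manifold].
- exact: costar_act_smooth.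
- by split; [exact: costar_actM|exact: costar_act1].
- exact: costar_gb_base.
- move=> x; have [T AT Tx] := gpab_cover x.
  have [s [oT sm sK ps yd]] := costar_local_triv AT Tx.
  by exists (tdom T), (costar_coord T), s.
Qed.

End CostarGradedBundle.

(** The k-th coordinate of the image of z is the coefficient of eps^(wt k) in z(phi(y_k)). It is a
    component of the dual of phi in degree wt k, applied to a functional whose dual coordinates are
    monomials in the coordinates of z. *)
Lemma costar_mor_is_gbmor (R : realType) (B A : gpab R) (phi : zak B A) :
  @is_gbmor R (costar A) (costar B) (costar_mor phi) (zbase phi).
Proof.
have [sb hf df] := zakP phi; split=> [z _|t z|z] //; last first.
  by apply: costar_tot_eq.
have [T AT Tz] := gpab_cover (costar_proj z).
have [S BS Sz] := gpab_cover (zbase phi (costar_proj z)).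
have covM := @gpab_base_cover R A.
apply: (smooth_into_costar BS); first exact: Sz.
  apply: (@smooth_at_comp _ (costar_charted A) (pabase A) (pabase B)
    (@costar_proj R A) (zbase phi)) => //; first exact: costar_proj_smooth.
  exact: sb.
apply: smooth_at_row => k.
have [L [sL EL]] := df (wt k) S T (costar_proj z) BS AT Tz Sz.
(* The generator y_k is one of the monomials of weight wt k; j selects its component in the output
   of L. *)
have [j Ej] : exists j : 'I_#|wmon (padim B) (wt k)|, wmonX j = polyX k :> polyA R _.
  have mk : mwt (mX k) = wt k.
    by have := @polyX_homog R _ k; apply; rewrite /polyX mcoeffX eqxx oner_eq0.
  by have [j Ej] := wmexp_surj mk; exists j; rewrite wmexpE Ej.
pose N := #|wmon (padim A) (wt k)|.
pose v (w : costar_charted A) : 'rV[R]_N := \row_l monev (wmexp l) (costar_coord T w).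
apply: (@smooth_at_ext R (costar_charted A) (realC R)
  (fun w => (L (costar_proj w, v w) : 'rV[R]_#|wmon (padim B) (wt k)|) 0 j)).
  have nT := near_costar AT Tz.
  have nE := @costar_proj_continuous R A z _ EL.
  have nE' : \forall w \near z, forall eta : pafib (costar_proj w) -> R, dual_elt (wt k) eta ->
    dual_coord S (wt k) (fun a => eta (zfib phi (costar_proj w) a)) =
    L (costar_proj w, dual_coord T (wt k) eta) := nE.
  apply: filterS2 nT nE' => w Tw Ew.
  pose eta (a : pafib (costar_proj w)) : R := (sval (projT2 w) a)`_(wt k).
  have heta : dual_elt (wt k) eta.
    have [lw _ _] := svalP (projT2 w).
    by move=> c a b _ _; rewrite /eta lw coefD coefZ.
  have <- : dual_coord T (wt k) eta = v w.
    apply/rowP => l; rewrite !mxE /eta costar_pev // (pev_homog _ (@wmonX_comp R _ _ l)).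
    by rewrite coefZ coefXn eqxx mulr1 peval_wmonX.
  by rewrite -Ew // !mxE Ej.
apply: (@smooth_at_crd R (costar_charted A) _ (fun w => L (costar_proj w, v w)) j).
apply: (@smooth_at_comp _ (costar_charted A) (prodC (pabase A) (EucC R N)) _
  (fun w => (costar_proj w, v w)) L).
- by apply: coverP; [exact: covM|exact: coverE].
- apply: smooth_at_pair; first exact: costar_proj_smooth.
  apply: smooth_at_row => l.
  apply: (@smooth_at_ext R (costar_charted A) (realC R)
    (fun w => monev (wmexp l) (costar_coord T w))).
    by apply: near_all => w; rewrite mxE.
  by apply: smooth_at_monev; exact: costar_coord_smooth.
- exact: sL.
Qed.

(** * Unit and counit *)


Section Unit.
Variables (R : realType) (F : gb R).
Notation SF := (GPAB (star_is_gpab F)).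
Notation TSF := (costar_charted SF).

Lemma fibre_ev_hom (x : gbbase F) (q : fibre x) :
  galg_hom (fun a : homG_galg x => a q : epsA R).
Proof.
split.
- by move=> k a b /=; rewrite scale1r addr0.
- by [].
- by move=> i a; exact.
Qed.

Definition unit_fib (x : gbbase F) (q : fibre x) : TSF :=
  existT _ x (exist _ (fun a : homG_galg x => a q : epsA R) (fibre_ev_hom q)).

Definition unit_map (p : gbtot F) : TSF := unit_fib (exist _ p erefl).

Lemma unit_fibE x (q : fibre x) : unit_map (sval q) = unit_fib q.
Proof. by case: q => p px; subst x. Qed.

Lemma unit_map_act t p : unit_map (gbact t p) = costar_act t (unit_map p).
Proof.
rewrite (unit_fibE (fibre_act t (exist _ p erefl))).
by apply: costar_tot_eq => a; exact: homeq.
Qed.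

Lemma ccrd_unit U y s (H : @local_triv R F U y s) p : U (gbproj p) ->
  ccrd (A := SF) (bundle_triv H) (unit_map p) = (gbproj p, y p).
Proof.
move=> Up; congr (_, _); apply/rowP => k; rewrite mxE.
rewrite [sval _ _](triv_mapE H (polyX k) (exist _ p erefl) Up) pevX coefZ coefXn eqxx.
exact: mulr1.
Qed.

Lemma unit_map_inj : injective unit_map.
Proof.
move=> p p' E; have [U [y [s [H Up]]]] := gb_local_triv (gbproj p).
have Ep : gbproj p = gbproj p' := congr1 (@costar_proj R SF) E.
have Up' : U (gbproj p') by rewrite -Ep.
have := congr1 (ccrd (A := SF) (bundle_triv H)) E.
rewrite !ccrd_unit // => -[_ Ey]; have [_ _ sK _ _] := H.
by rewrite -(sK p Up) -(sK p' Up') Ep Ey.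
Qed.

Lemma unit_map_triv U y s (H : @local_triv R F U y s) (z : TSF) :
  U (costar_proj z) -> unit_map (s (ccrd (A := SF) (bundle_triv H) z)) = z.
Proof.
move=> Uz; have [_ _ _ ps _] := H.
have [Ep Ey] := ps (ccrd (A := SF) (bundle_triv H) z) Uz.
have Us : U (gbproj (s (ccrd (A := SF) (bundle_triv H) z))) by rewrite Ep.
apply: (costar_ext (A := SF) (T := bundle_triv H)) => //.
  exact: bundle_triv_in.
by rewrite (ccrd_unit H Us) Ep Ey.
Qed.

Lemma unit_map_surj z : exists p, unit_map p = z.
Proof.
have [U [y [s [H Uz]]]] := gb_local_triv (costar_proj z).
by exists (s (ccrd (A := SF) (bundle_triv H) z)); exact: unit_map_triv.
Qed.

Lemma unit_map_smooth : smooth (unit_map : gbtot F -> TSF).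
Proof.
move=> p _; have [U [y [s [H Up]]]] := gb_local_triv (gbproj p).
have [oU [sy _] _ _ _] := H.
apply: (smooth_into_costar (A := SF) (T := bundle_triv H)) => //.
- exact: bundle_triv_in.
- exact: gb_proj_smooth.
apply: (@smooth_at_ext _ _ (EucC R (nvar (gbdim F))) y); last exact: sy.
apply: filterS (near_proj oU Up) => p' Up'.
by have [] := ccrd_unit H Up'.
Qed.

Lemma unit_is_gbmor :
  @is_gbmor R F (costar SF) unit_map (fun x => x).
Proof. by split => //; [exact: unit_map_smooth|exact: unit_map_act]. Qed.

(** Over U the inverse is s composed with the coordinates of the induced trivialization, hence
    smooth; equivariance follows from the injectivity of the unit. *)
Lemma unit_inv_is_gbmor (g : TSF -> gbtot F) : cancel g unit_map ->
  @is_gbmor R (costar SF) F g (fun x => x).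
Proof.
move=> gK; split=> [z _|t z|z].
- have [U [y [s [H Uz]]]] := gb_local_triv (costar_proj z).
  have AT : patriv SF (bundle_triv H) := bundle_triv_in H.
  have [_ [_ ss] _ _ _] := H.
  apply: (@smooth_at_ext _ TSF (gbtot F)
    (fun z' => s (ccrd (A := SF) (bundle_triv H) z'))).
    apply: filterS (near_costar AT Uz) => z' Uz'.
    by apply: unit_map_inj; rewrite gK; exact: unit_map_triv.
  apply: (@smooth_at_comp _ TSF (prodC (gbbase F) (EucC R (nvar (gbdim F)))) _
    (ccrd (A := SF) (bundle_triv H)) s).
  + by apply: coverP; [exact: gb_base_cover|exact: coverE].
  + apply: smooth_at_pair; first exact: costar_proj_smooth.
    exact: (costar_coord_smooth AT Uz).
  + exact: ss.
- by apply: unit_map_inj; rewrite unit_map_act !gK.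
- exact: (congr1 (@costar_proj R SF) (gK z)).
Qed.

End Unit.

(** * The counit *)

Section Counit.
Variables (R : realType) (A : gpab R).
Notation TA := (GB (costar_is_gb A)).
Notation hfib x := ({z : pafib (p := A) x -> epsA R | galg_hom z}).

Definition fibre_pt x (u : hfib x) : @fibre R TA x :=
  exist (fun z : costar_tot A => costar_proj z = x) (existT _ x u) erefl.

Lemma fibre_ptE x (q : @fibre R TA x) : exists u, q = fibre_pt u.
Proof. by case: q => [[y u] /= E]; subst x; exists u. Qed.

(** The homomorphism stored in q lives on the algebra over a base point that is only provably equal
    to x; the match transports it to the algebra over x before it is applied to a. *)
Definition counit_ev x (a : pafib (p := A) x) (q : @fibre R TA x) : epsA R :=
  match svalP q in _ = y return pafib (p := A) y -> epsA R with
  | erefl => sval (projT2 (sval q))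
  end a.

Lemma counit_evE x a (u : hfib x) : counit_ev a (fibre_pt u) = sval u a.
Proof. by rewrite /counit_ev (_ : svalP (fibre_pt u) = erefl). Qed.

Lemma counit_ev_eq x a (q : @fibre R TA x) (u : hfib x) :
  sval q = existT _ x u -> counit_ev a q = sval u a.
Proof. by move=> E; rewrite -(counit_evE a u); congr counit_ev; exact: fibre_eq. Qed.

Lemma counit_ev_triv T x (p : polyA R (padim A)) (q : @fibre R TA x) :
  patriv A T -> tdom T x ->
  counit_ev (tmap T x p) q = pev (costar_coord T (sval q)) p.
Proof.
move=> AT Tx; have [u ->] := fibre_ptE q.
by rewrite counit_evE -(costar_pev _ AT).
Qed.

Lemma counit_sm x (a : pafib (p := A) x) k :
  fibre_smooth (fun q : @fibre R TA x => trunc k (counit_ev a q)).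
Proof.
have [T AT Tx] := gpab_cover x.
have [g [_ gK _ _]] := gpab_iso AT Tx.
have [s H] := costar_local_triv AT Tx.
have := @triv_fun_sm R TA _ _ _ H x Tx (g a) k.
apply: fibre_smooth_ext => q.
by rewrite -(counit_ev_triv _ _ AT Tx) gK.
Qed.

Lemma counit_eq x (a : pafib (p := A) x) t (q : @fibre R TA x) :
  counit_ev a (fibre_act t q) = epsact t (counit_ev a q).
Proof.
have [T AT Tx] := gpab_cover x; have [g [_ gK _ _]] := gpab_iso AT Tx.
rewrite -(gK a) !(counit_ev_triv _ _ AT Tx) epsact_pev; congr (pev _ _).
exact: costar_coord_act.
Qed.

Definition counit_fib x (a : pafib (p := A) x) : homG_galg (F := TA) x :=
  HomG (counit_sm a) (counit_eq a).

Lemma counit_triv T s (H : @local_triv R TA (tdom T) (costar_coord T) s) x p :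
  patriv A T -> tdom T x -> counit_fib (tmap T x p) = triv_map H x p.
Proof.
by move=> AT Tx; apply: homG_eq => q; rewrite triv_mapE //; exact: counit_ev_triv.
Qed.

Lemma counit_iso x : galg_iso (@counit_fib x).
Proof.
have [T AT Tx] := gpab_cover x.
have [s H] := costar_local_triv AT Tx.
have [g [gK Kg hT hg]] := gpab_iso AT Tx.
have [h [hK Kh ht hh]] := triv_map_iso (F := TA) H Tx.
have E a : counit_fib a = triv_map (F := TA) H x (g a).
  by rewrite -(counit_triv H _ AT Tx) Kg.
exists (fun b => tmap T x (h b)); split.
- by move=> a; rewrite E hK Kg.
- by move=> b; rewrite E gK Kh.
- rewrite (_ : @counit_fib x = fun a => triv_map (F := TA) H x (g a)).
    exact: galg_hom_comp.
  exact/funext.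
- exact: galg_hom_comp.
Qed.

Definition counit_inv x : homG_galg (F := TA) x -> pafib (p := A) x :=
  projT1 (cid (counit_iso x)).

Lemma counit_invP x : [/\ cancel (@counit_fib x) (@counit_inv x),
  cancel (@counit_inv x) (@counit_fib x), galg_hom (@counit_fib x)
  & galg_hom (@counit_inv x)].
Proof. exact: (projT2 (cid (counit_iso x))). Qed.

Lemma counit_is_zak : @is_zak R A (star TA) (fun x => x) counit_fib.
Proof.
split=> [|x|i].
- exact: manifold_id (gpab_manifold A).
- by have [] := counit_invP x.
apply: dual_smooth_sections.
- exact: gpabP.
- exact: star_is_gpab.
- by move=> x; exact: cvg_id.
- by move=> x; have [] := counit_invP x.
move=> S T j AS ST; have [oT isoT HT] := ST.
have oO : open (tdom T `&` tdom S) by apply: openI => //; exact: gpab_open.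
apply/(HT i (tdom T `&` tdom S) (fun x => counit_fib (tmap S x (wmonX j))) oO).
- by move=> x [].
- move=> x [_ Sx]; have [_ _ [_ _ hc] _] := counit_invP x.
  have [g [_ _ [_ _ hS] _]] := gpab_iso AS Sx.
  by apply/hc/hS; exact: wmonX_comp.
(* The section that comes from S is constant in the trivialization which S induces on [star TA], so
   its function on the total space is smooth. *)
move=> p [Tp Sp]; have [s H] := costar_local_triv AS Sp.
have := sect_fun_const (bundle_triv_in (F := TA) H) (@wmonX_comp R _ i j) oO _ (conj Tp Sp).
move=> /(_ (fun x => @proj2 _ _)); apply: smooth_at_ext.
apply: filterS (near_proj (F := TA) oO (conj Tp Sp)) => z [_ Sz].
have E := counit_triv H (wmonX j) AS Sz.
exact: (congr1 (fun b : @homG R TA (gbproj z) => (b (exist _ z erefl))`_i) (esym E)).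
Qed.

Lemma counit_inv_is_zak : @is_zak R (star TA) A (fun x => x) counit_inv.
Proof.
split=> [|x|i].
- exact: manifold_id (gpab_manifold A).
- by have [] := counit_invP x.
apply: dual_smooth_sections.
- exact: star_is_gpab.
- exact: gpabP.
- by move=> x; exact: cvg_id.
- by move=> x; have [] := counit_invP x.
move=> S T j SS AT; have [oS isoS _] := SS.
(* A base point is needed to extend the local inverse of [costar_coord T]. *)
have [[x0 [Tx0 _]]|O0] := pselect (exists x, (tdom T `&` tdom S) x); last first.
  exists (fun=> 0); split=> [m x _|x Ox]; first exact: smooth_at_cst.
  by case: O0; exists x.
have [s H] := costar_local_triv AT Tx0.
have [_ _ HT] := bundle_triv_in (F := TA) H.
have oO : open (tdom T `&` tdom S) by apply: openI => //; exact: gpab_open.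
have [|sm _] := HT i (tdom T `&` tdom S) (fun x => tmap S x (wmonX j)) oO
  (@subIsetl _ _ _).
  by move=> x [_ Sx]; have [g [_ _ [_ _ hS] _]] := isoS x Sx; apply: hS; exact: wmonX_comp.
(* These are coefficients in the trivialization induced by T. The counit is the identity between it
   and T, so c also describes the image under [counit_inv]. *)
have [c [sc Ec]] := sm (sect_fun_const SS (@wmonX_comp R _ i j) oO (@subIsetr _ _ _)).
exists c; split => // x [Tx Sx]; have [K _ _ _] := counit_invP x.
by rewrite -[RHS]K (counit_triv H) // Ec.
Qed.

End Counit.


(** * The natural isomorphisms *)

Section Equivalence.
Variable R : realType.
Notation Sf := (star_functor (@star_is_gpab R) (@star_mor_is_zak R)).
Notation Tf := (costar_functor (@costar_is_gb R) (@costar_mor_is_gbmor R)).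

Definition unit_mor (F : GBcat R) : hom F (Tf (Sf F)) := GBMor (unit_is_gbmor F).

Lemma unit_mor_iso (F : GBcat R) : is_iso (unit_mor F).
Proof.
have [g Kg gK] := surj_inv (@unit_map_inj R F) (@unit_map_surj R F).
exists (GBMor (unit_inv_is_gbmor gK)).
by split; apply: gbmor_eq => //; apply/funext.
Qed.

Lemma unit_mor_natural (F E : GBcat R) (f : hom F E) :
  cmp (unit_mor E) f = cmp (fmor Tf (fmor Sf f)) (unit_mor F).
Proof.
apply: gbmor_eq; last by [].
(* Both sides evaluate at the image of p; [unit_fibE] moves the left side to the fibre in which
   [fibre_map] places this image. *)
apply/funext => p /=; rewrite (unit_fibE (fibre_map f (exist _ p erefl))).
exact: costar_tot_eq.
Qed.

Definition counit_mor (A : GPABcat R) : hom A (Sf (Tf A)) := Zak (counit_is_zak A).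

Lemma counit_mor_iso (A : GPABcat R) : is_iso (counit_mor A).
Proof.
exists (Zak (counit_inv_is_zak A)); split; apply: zak_eq => x a /=.
  by have [K _ _ _] := counit_invP x; exact: K.
by have [_ K _ _] := @counit_invP R A x; exact: K.
Qed.

Lemma counit_mor_natural (A B : GPABcat R) (f : hom A B) :
  cmp (counit_mor B) f = cmp (fmor Sf (fmor Tf f)) (counit_mor A).
Proof.
apply: zak_eq => x a; apply: homG_eq => q /=.
have [u ->] := fibre_ptE q; rewrite counit_evE.
(* The membership proof here is the one built by [fibre_map]; [counit_ev_eq] depends only on the
   underlying point. *)
apply: esym; exact: (@counit_ev_eq R A (zbase f x) a _
  (projT2 (costar_mor f (existT _ x u)))).
Qed.

End Equivalence.

Theorem theorem4p9 (R : realType) :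
  exists (HS : forall F : gb R, is_gpab (star F))
    (HSm : forall (F E : gb R) (f : gbmor F E),
       @is_zak R (star E) (star F) (gbmbase f) (star_mor f))
    (HT : forall A : gpab R, is_gb (costar A))
    (HTm : forall (B A : gpab R) (phi : zak B A),
       @is_gbmor R (costar A) (costar B) (costar_mor phi) (zbase phi)),
    dual_equivalence (star_functor HS HSm) (costar_functor HT HTm).
Proof.
exists (@star_is_gpab R), (@star_mor_is_zak R), (@costar_is_gb R), (@costar_mor_is_gbmor R).
split.
- exists (@unit_mor R); split; first exact: unit_mor_iso.
  exact: unit_mor_natural.
- exists (@counit_mor R); split; first exact: counit_mor_iso.
  exact: counit_mor_natural.
Qed.
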